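(* Let ${}^2\mathsf X_n(k,\theta)$ be a twisted Chevalley group, of type ${}^2\mathsf B_2$ ($p=2$), ${}^2\mathsf G_2$ ($p=3$) or ${}^2\mathsf F_4$ ($p=2$). Then there exist a twisted group scheme $\tilde X$ (of characteristic $p$) and a blended field $b$ such that ${}^2\mathsf X_n(k,\theta)\cong\tilde X(b)$ as groups.
   Context: Fix a prime $p$. All schemes and rings have characteristic $p$, i.e. lie over $\mathbf F_p$. $\mathrm{Fr}_X$ denotes the absolute Frobenius of a scheme $X$ and $\mathrm{fr}_k:x\mapsto x^p$ the Frobenius of a ring $k$. Twisted schemes. The category of twisted schemes has as objects the pairs $(X,\Phi_X)$ with $X$ a scheme of characteristic $p$ and $\Phi_X:X\to X$ an endomorphism with $\Phi_X\circ\Phi_X=\mathrm{Fr}_X$; a morphism $(X,\Phi_X)\to(Y,\Phi_Y)$ is a morphism of schemes $f:X\to Y$ with $\Phi_Y\circ f=f\circ\Phi_X$. It has fibered products and the terminal object $(\mathrm{Spec}\,\mathbf F_p,\mathrm{id})$. A twisted group scheme is a group object in this category. A blended field is a pair $b=(k,\psi)$ with $k$ a field of characteristic $p$ and $\psi$ an endomorphism of $k$ with $\psi^2(x)=x^p$ for all $x$; $\mathrm{Spec}\,b=(\mathrm{Spec}\,k,\mathrm{Spec}\,\psi)$ is a twisted scheme. $\tilde X(b)$ is the group of morphisms of twisted schemes $\mathrm{Spec}\,b\to\tilde X$. Twisted Chevalley groups. Let $(\mathsf X_n,p)$ be $(\mathsf B_2,2)$, $(\mathsf G_2,3)$ or $(\mathsf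 F_4,2)$, and let $\mathsf X_n$ also denote the split algebraic group over $\mathbf F_p$ of that type, with a pinning: a split maximal torus, a system $\Delta$ of fundamental roots and root group parametrizations $x_r$. There is an endomorphism $g:\mathsf X_n\to\mathsf X_n$ of algebraic $\mathbf F_p$-groups (the exceptional graph endomorphism) such that $g\circ g$ is the Frobenius endomorphism of $\mathsf X_n$ and, for $r\in\pm\Delta$, $g(x_r(t))=x_{\bar r}(t)$ if $r$ is long and $g(x_r(t))=x_{\bar r}(t^p)$ if $r$ is short, where $r\mapsto\bar r$ is the length-interchanging symmetry of the Dynkin diagram (extended to $-\Delta$). Let $k$ be a field of characteristic $p$ and $\theta\in\mathrm{Aut}(k)$ with $\mathrm{fr}_k\circ\theta^2=\mathrm{id}_k$ (so $k$ is perfect). Then $\theta$ acts on $\mathsf X_n(k)$ through its action on $k$, $g\theta$ is an automorphism of the abstract group $\mathsf X_n(k)$ whose square is the identity, and the twisted Chevalley group ${}^2\mathsf X_n(k,\theta)$ is the group of fixed points of $g\theta$ in $\mathsf X_n(k)$. *)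

(* Defs.v *)
From HB Require Import structures.
From mathcomp Require Import all_boot all_order all_algebra.
From mathcomp Require Import all_classical topology.
From mathcomp Require Import ring.

Set Implicit Arguments.
Unset Strict Implicit.
Unset Printing Implicit Defensive.

Import GRing.Theory.
Local Open Scope quotient_scope.
Local Open Scope classical_set_scope.
Local Open Scope ring_scope.
#[local] Obligation Tactic := idtac.

Record prime_ideal (A : comPzRingType) := PrimeIdeal {
  pset :> A -> Prop;
  pset0 : pset 0;
  psetD : forall a b, pset a -> pset b -> pset (a + b);
  psetM : forall a b, pset b -> pset (a * b);
  pset1 : ~ pset 1;
  pset_prime : forall a b, pset (a * b) -> pset a \/ pset b }.

HB.instance Definition _ (A : comPzRingType) := gen_eqMixin (prime_ideal A).
HB.instance Definition _ (A : comPzRingType) := gen_choiceMixin (prime_ideal A).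

Lemma prime_ideal_ext (A : comPzRingType) (P Q : prime_ideal A) :
  (forall a, P a <-> Q a) -> P = Q.
Proof.
case: P => P ? ? ? ? ?; case: Q => Q ? ? ? ? ? /= e.
have {}e : P = Q by apply/seteqP; split=> a /e.
by subst Q; congr PrimeIdeal; apply: Prop_irrelevance.
Qed.

Module Localization.
Section Localization.
Variables (A : comPzRingType) (P : prime_ideal A).

Record frac := Frac { num : A; den : A; denP : ~ P den }.
HB.instance Definition _ := gen_eqMixin frac.
HB.instance Definition _ := gen_choiceMixin frac.

Lemma mulP s t : ~ P s -> ~ P t -> ~ P (s * t).
Proof. by move=> ? ? /pset_prime[]. Qed.

Definition eqf (x y : frac) :=
  `[< exists2 u : A, ~ P u & u * (num x * den y) = u * (num y * den x) >].

Lemma eqf_refl : reflexive eqf.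
Proof. by move=> x; apply/asboolP; exists 1; first exact: pset1. Qed.

Lemma eqf_sym : symmetric eqf.
Proof.
by move=> x y; apply/idP/idP => /asboolP[u ? e]; apply/asboolP; exists u.
Qed.

Lemma eqf_trans : transitive eqf.
Proof.
move=> y x z /asboolP[u Pu e] /asboolP[v Pv f]; apply/asboolP.
exists (u * v * den y); first exact/mulP/denP/mulP.
transitivity ((u * (num x * den y)) * (v * den z)); first by ring.
rewrite e; transitivity ((v * (num y * den z)) * (u * den x)); first by ring.
by rewrite f; ring.
Qed.

Canonical eqf_equiv := EquivRel eqf eqf_refl eqf_sym eqf_trans.
Definition type := {eq_quot eqf}.
HB.instance Definition _ : EqQuotient _ eqf type := EqQuotient.on type.
HB.instance Definition _ := Choice.on type.

Definition mk (a s : A) (Ps : ~ P s) : type := \pi_type (Frac a Ps).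

Lemma mk_eq a s (Ps : ~ P s) b t (Pt : ~ P t) :
  mk a Ps = mk b Pt <-> exists2 u, ~ P u & u * (a * t) = u * (b * s).
Proof.
split.
  by move=> /eqmodP /asboolP.
by move=> e; apply/eqmodP/asboolP.
Qed.

Lemma mk_surj (x : type) : exists a s (Ps : ~ P s), x = mk a Ps.
Proof. by elim/quotW: x => -[a s Ps]; exists a, s, Ps. Qed.

Lemma Frac_eta f (Pf : ~ P (den f)) : Frac (num f) Pf = f.
Proof. by case: f Pf => a s Ps Ps' /=; congr Frac; apply: Prop_irrelevance. Qed.

Definition nm (x : type) := num (repr x).
Definition dn (x : type) := den (repr x).
Lemma dnP (x : type) : ~ P (dn x). Proof. exact: denP. Qed.
Lemma reprE (x : type) : x = mk (nm x) (@dnP x).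
Proof.
by rewrite -[LHS]reprK /mk Frac_eta.
Qed.

Definition add (x y : type) : type :=
  mk (nm x * dn y + nm y * dn x) (mulP (@dnP x) (@dnP y)).
Definition opp (x : type) : type := mk (- nm x) (@dnP x).
Definition mul (x y : type) : type := mk (nm x * nm y) (mulP (@dnP x) (@dnP y)).
Definition zero : type := mk 0 (@pset1 A P).
Definition one : type := mk 1 (@pset1 A P).

Lemma mkD a s (Ps : ~ P s) b t (Pt : ~ P t) :
  add (mk a Ps) (mk b Pt) = mk (a * t + b * s) (mulP Ps Pt).
Proof.
have [u Pu e] := (mk_eq _ _ _ _).1 (reprE (mk a Ps)).
have [v Pv f] := (mk_eq _ _ _ _).1 (reprE (mk b Pt)).
apply/mk_eq; exists (u * v); first exact: mulP.
move: (nm (mk a Ps)) (dn (mk a Ps)) e => c s' e.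
move: (nm (mk b Pt)) (dn (mk b Pt)) f => d t' f.
transitivity ((u * (c * s)) * (v * t' * t) + (v * (d * t)) * (u * s' * s)); first by ring.
by rewrite -e -f; ring.
Qed.

Lemma mkN a s (Ps : ~ P s) : opp (mk a Ps) = mk (- a) Ps.
Proof.
have [u Pu e] := (mk_eq _ _ _ _).1 (reprE (mk a Ps)).
apply/mk_eq; exists u => //.
by transitivity (- (u * (nm (mk a Ps) * s))); [ring|rewrite -e; ring].
Qed.

Lemma mkM a s (Ps : ~ P s) b t (Pt : ~ P t) :
  mul (mk a Ps) (mk b Pt) = mk (a * b) (mulP Ps Pt).
Proof.
have [u Pu e] := (mk_eq _ _ _ _).1 (reprE (mk a Ps)).
have [v Pv f] := (mk_eq _ _ _ _).1 (reprE (mk b Pt)).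
apply/mk_eq; exists (u * v); first exact: mulP.
move: (nm (mk a Ps)) (dn (mk a Ps)) e => c s' e.
move: (nm (mk b Pt)) (dn (mk b Pt)) f => d t' f.
transitivity ((u * (c * s)) * (v * (d * t))); first by ring.
by rewrite -e -f; ring.
Qed.

Lemma mkE a s (Ps : ~ P s) b t (Pt : ~ P t) : a * t = b * s -> mk a Ps = mk b Pt.
Proof. by move=> e; apply/mk_eq; exists 1; [exact: pset1|rewrite e]. Qed.

Ltac lift3 := repeat (let x := fresh in move=> x;
  let a := fresh "a" in let s := fresh "s" in let Ps := fresh "Ps" in
  case: (mk_surj x) => a [s [Ps ->]]); rewrite ?(mkD, mkN, mkM); apply: mkE; ring.

Lemma addA : associative add. Proof. lift3. Qed.
Lemma addC : commutative add. Proof. lift3. Qed.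
Lemma add0 : left_id zero add. Proof. rewrite /zero; lift3. Qed.
Lemma addN : left_inverse zero opp add. Proof. rewrite /zero; lift3. Qed.
Lemma mulA : associative mul. Proof. lift3. Qed.
Lemma mulC : commutative mul. Proof. lift3. Qed.
Lemma mul1 : left_id one mul. Proof. rewrite /one; lift3. Qed.
Lemma mulDl : left_distributive mul add. Proof. lift3. Qed.

HB.instance Definition _ := GRing.isZmodule.Build type addA addC add0 addN.
HB.instance Definition _ :=
  GRing.Zmodule_isComPzRing.Build type mulA mulC mul1 mulDl.

End Localization.
End Localization.
HB.export Localization.
Notation localization := Localization.type.

Lemma eq_rmorphism (R S : pzSemiRingType) (f g : {rmorphism R -> S}) :
  f =1 g -> f = g.
Proof.
case: f g => [f [[a] [b]]] [g [[c] [d]]] /= /funext e; subst g.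
have -> : a = c by apply: Prop_irrelevance.
by have -> : b = d by apply: Prop_irrelevance.
Qed.

Record opens (X : topologicalType) := Opens {
  oset :> X -> Prop;
  oset_open : open oset }.

Definition osub (X : topologicalType) (V U : X -> Prop) := forall x, V x -> U x.
Notation "V `<=o` U" := (osub V U) (at level 70).

Lemma opens_ext (X : topologicalType) (U V : opens X) :
  U `<=o` V -> V `<=o` U -> U = V.
Proof.
case: U V => U ? [V ?] /= UV VU; have e : U = V by apply/seteqP.
by subst V; congr Opens; apply: Prop_irrelevance.
Qed.

Definition opre (X Y : topologicalType) (f : X -> Y) (cf : continuous f)
  (V : opens Y) : opens X :=
  Opens ((continuousP _).1 cf V (oset_open V)).

Definition ocap (X : topologicalType) (U V : opens X) : opens X :=
  Opens (openI (oset_open U) (oset_open V)).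

Record ringed_space := RingedSpace {
  carrier :> topologicalType;
  sect : opens carrier -> comPzRingType;
  res : forall U V : opens carrier, V `<=o` U -> {rmorphism sect U -> sect V};
  res_id : forall (U : opens carrier) (h : U `<=o` U) (s : sect U), res h s = s;
  res_res : forall (U V W : opens carrier) (h : V `<=o` U) (h' : W `<=o` V)
    (h'' : W `<=o` U) (s : sect U), res h' (res h s) = res h'' s }.

Definition is_sheaf (X : ringed_space) : Prop :=
  forall (I : Type) (V : opens X) (U : I -> opens X)
    (UV : forall i, U i `<=o` V),
  (forall x, V x -> exists i, U i x) ->
  forall s : forall i, sect (U i),
  (forall i j (W : opens X) (hi : W `<=o` U i) (hj : W `<=o` U j),
     res hi (s i) = res hj (s j)) ->
  exists! t : sect V, forall i, res (UV i) t = s i.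

(* The germ at [x] of the section [s] over [U] is invertible in the stalk. *)
Definition germ_unit (X : ringed_space) (x : X) (U : opens X) (s : sect U) :=
  exists (W : opens X) (h : W `<=o` U), W x /\ exists t, res h s * t = 1.

(* The stalks are local rings: the germ 0 is not invertible, and if a sum of
   two germs is invertible then so is one of them. *)
Definition local_stalks (X : ringed_space) : Prop :=
  forall (x : X) (U : opens X), U x ->
    ~ germ_unit x (0 : sect U) /\
    forall s t : sect U,
      germ_unit x (s + t) -> germ_unit x s \/ germ_unit x t.

(* Morphisms of locally ringed spaces: [comap] is the map of sheaves from the
   structure sheaf of [Y] to the direct image of the structure sheaf of [X], and
   [mlocal] says that the maps on stalks reflect units, i.e. are local. *)
Record lrs_mor (X Y : ringed_space) := LrsMor {
  mfun :> X -> Y;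
  mcont : continuous mfun;
  comap : forall V : opens Y, {rmorphism sect V -> sect (opre mcont V)};
  comap_res : forall (V W : opens Y) (h : W `<=o` V)
    (h' : opre mcont W `<=o` opre mcont V) (s : sect V),
    res h' (comap V s) = comap W (res h s);
  mlocal : forall (x : X) (V : opens Y) (s : sect V), V (mfun x) ->
    germ_unit x (comap V s) -> germ_unit (mfun x) s }.

Arguments mcont {X Y} _ : rename.

Lemma res_irr (X : ringed_space) (U V : opens X) (h h' : V `<=o` U) s :
  res h s = res h' s.
Proof. by congr (res _ s); apply: Prop_irrelevance. Qed.

Lemma lrs_mor_ext (X Y : ringed_space) (f g : lrs_mor X Y) :
  (forall x, f x = g x) ->
  (forall (V : opens Y) (s : sect V) (W : opens X)
     (hf : W `<=o` opre (mcont f) V) (hg : W `<=o` opre (mcont g) V),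
     res hf (comap f V s) = res hg (comap g V s)) ->
  f = g.
Proof.
case: f g => f cf f' fr fl [g cg g' gr gl] /= /funext e; subst g.
have ec : cf = cg by apply: Prop_irrelevance.
subst cg => e.
have es : f' = g'.
  apply: functional_extensionality_dep => V.
  have ev : f' V =1 g' V.
    move=> s; have h : opre cf V `<=o` opre cf V by [].
    by move: (e V s _ h h); rewrite !res_id.
  by apply/eq_rmorphism.
subst g'; congr LrsMor; exact: Prop_irrelevance.
Qed.

Lemma res_sub (X : ringed_space) (U V W : opens X) (h : W `<=o` V)
  (h' : V `<=o` U) : W `<=o` U.
Proof. by move=> x /h /h'. Qed.

Lemma resK (X : ringed_space) (U V : opens X) (h : V `<=o` U) (h' : U `<=o` V)
  (s : sect U) : res h' (res h s) = s.
Proof. by rewrite (res_res _ _ (fun x Ux => Ux)) res_id. Qed.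

Lemma germ_unit_res (X : ringed_space) (x : X) (U V : opens X) (h : V `<=o` U)
  (s : sect U) : V x -> germ_unit x (res h s) <-> germ_unit x s.
Proof.
move=> Vx; split=> -[W [hW [Wx [t e]]]].
  exists W, (res_sub hW h); split=> //; exists t.
  by rewrite -e (res_res _ hW (res_sub hW h)).
have h1 : ocap V W `<=o` V by move=> y [].
have h2 : ocap V W `<=o` W by move=> y [].
exists (ocap V W), h1; split=> //; exists (res h2 t).
rewrite (res_res h h1 (res_sub h1 h)) -(res_irr (res_sub h2 hW)).
by rewrite -(res_res hW h2) -rmorphM e rmorph1.
Qed.

Section Composition.
Variables (X Y Z : ringed_space).

Lemma id_pre (V : opens X) :
  opre (fun x : X => (@cvg_id _ (nbhs x)) : _ --> _) V `<=o` V.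
Proof. by []. Qed.

Program Definition lrs_id : lrs_mor X X :=
  @LrsMor X X idfun (fun x => @cvg_id _ (nbhs x))
    (fun V => res (@id_pre V)) _ _.
Next Obligation.
by move=> V W h h' s /=; rewrite !(res_res _ _ (res_sub h' (@id_pre V))).
Qed.
Next Obligation. by move=> x V s Vx /germ_unit_res; apply. Qed.

Variables (g : lrs_mor Y Z) (f : lrs_mor X Y).

Lemma comp_cont : continuous (g \o f).
Proof. by move=> x; apply: continuous_comp; apply: mcont. Qed.

Lemma comp_pre (V : opens Z) :
  opre comp_cont V `<=o` opre (mcont f) (opre (mcont g) V).
Proof. by []. Qed.

Program Definition lrs_comp : lrs_mor X Z :=
  @LrsMor X Z (g \o f) comp_cont
    (fun V => res (@comp_pre V) \o comap f (opre (mcont g) V) \o comap g V) _ _.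
Next Obligation.
move=> V W h h' s /=.
have hg : opre (mcont g) W `<=o` opre (mcont g) V by move=> y; apply: h.
have hf : opre (mcont f) (opre (mcont g) W) `<=o` opre (mcont f) (opre (mcont g) V).
  by move=> y; apply: hg.
by rewrite -(comap_res _ hg) -(comap_res _ hf) !(res_res _ _ (res_sub h' (@comp_pre V))).
Qed.
Next Obligation.
move=> x V s Vx u; apply: mlocal => //; apply: mlocal => //.
by move: u => /germ_unit_res; apply.
Qed.

End Composition.

Arguments comp_cont {X Y Z} g f : rename.
Arguments comp_pre {X Y Z} g f V : rename.

Lemma lrs_compA (X Y Z T : ringed_space) (h : lrs_mor Z T) (g : lrs_mor Y Z)
  (f : lrs_mor X Y) : lrs_comp h (lrs_comp g f) = lrs_comp (lrs_comp h g) f.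
Proof.
apply: lrs_mor_ext => // V s W hf hg /=.
have h1 : opre (mcont f) (opre (comp_cont h g) V) `<=o`
  opre (mcont f) (opre (mcont g) (opre (mcont h) V)) by [].
rewrite -(comap_res _ h1).
have hW : W `<=o` opre (mcont f) (opre (mcont g) (opre (mcont h) V)) by [].
have hW1 : W `<=o` opre (comp_cont g f) (opre (mcont h) V) by [].
have hW2 : W `<=o` opre (mcont f) (opre (comp_cont h g) V) by [].
by rewrite (res_res _ _ hW1) (res_res _ _ hW) (res_res _ _ hW2) (res_res _ _ hW).
Qed.

(* An isomorphism onto an open subspace. *)
Definition open_immersion (X Y : ringed_space) (j : lrs_mor X Y) : Prop :=
  [/\ injective j, forall U : set X, open U -> open (j @` U) &
      forall V : opens Y, V `<=o` range j -> bijective (comap j V)].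

Section SpecTopology.
Variable A : comPzRingType.

(* The complements of the zero loci of subsets [S] of [A]. *)
Definition zariski_open (U : set (prime_ideal A)) : Prop :=
  exists S : A -> Prop, U = [set P | exists2 a, S a & ~ P a].

Lemma zariski_openT : zariski_open setT.
Proof.
exists (fun a => a = 1); apply/seteqP; split=> // P _.
by exists 1; last exact: pset1.
Qed.

Lemma zariski_openI : setI_closed zariski_open.
Proof.
move=> _ _ [S ->] [T ->].
exists (fun c => exists a b, [/\ S a, T b & c = a * b]).
apply/seteqP; split=> P /=.
  case=> -[a Sa Pa] [b Tb Pb]; exists (a * b); first by exists a, b.
  by case/pset_prime.
case=> _ [a [b [Sa Tb ->]]] Pab; split.
  by exists a => // Pa; apply: Pab; rewrite mulrC; apply: psetM.
by exists b => // Pb; apply: Pab; apply: psetM.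
Qed.

Lemma zariski_open_bigU (I : Type) (f : I -> set (prime_ideal A)) :
  (forall i, zariski_open (f i)) -> zariski_open (\bigcup_i f i).
Proof.
move=> fo; exists (fun a => exists i S,
  f i = [set P | exists2 a, S a & ~ P a] /\ S a).
apply/seteqP; split=> P /=.
  case=> i _; have [S e] := fo i; rewrite e => -[a Sa Pa].
  by exists a => //; exists i, S.
by case=> a [i [S [e Sa]]] Pa; exists i => //; rewrite e; exists a.
Qed.

End SpecTopology.

HB.instance Definition _ (A : comPzRingType) :=
  isOpenTopological.Build (prime_ideal A) (@zariski_openT A)
    (@zariski_openI A) (@zariski_open_bigU A).

Section StructureSheaf.
Variable A : comPzRingType.
Implicit Types U V W : opens (prime_ideal A).

Definition locally_fraction U (s : forall P, U P -> localization P) : Prop :=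
  forall P, U P -> exists V a f, [/\ V P, V `<=o` U &
    forall Q (UQ : U Q), V Q ->
      exists Qf : ~ Q f, s Q UQ = Localization.mk a Qf].

Record spec_sect U := SpecSect {
  spec_val :> forall P, U P -> localization P;
  spec_valP : locally_fraction spec_val }.

HB.instance Definition _ U := gen_eqMixin (spec_sect U).
HB.instance Definition _ U := gen_choiceMixin (spec_sect U).

Lemma spec_sect_ext U (s t : spec_sect U) :
  (forall P (UP : U P), s P UP = t P UP) -> s = t.
Proof.
case: s t => s hs [t ht] /= e; have {}e : s = t.
  by apply: functional_extensionality_dep => P;
     apply: functional_extensionality_dep => UP.
by subst t; congr SpecSect; apply: Prop_irrelevance.
Qed.

Variable U : opens (prime_ideal A).

Lemma lf_const (a : A) :
  locally_fraction (fun P (_ : U P) => Localization.mk a (@pset1 A P)).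
Proof. by move=> P UP; exists U, a, 1; split=> // Q _ _; exists (@pset1 A Q). Qed.

Lemma lf_opp (s : spec_sect U) :
  locally_fraction (fun P (UP : U P) => - s P UP).
Proof.
move=> P /(spec_valP s)[V [a [f [VP VU e]]]]; exists V, (- a), f; split=> // Q UQ VQ.
by have [Qf ->] := e Q UQ VQ; exists Qf; rewrite -Localization.mkN.
Qed.

Lemma lf_add (s t : spec_sect U) :
  locally_fraction (fun P (UP : U P) => s P UP + t P UP).
Proof.
move=> P UP; have [V [a [f [VP VU e]]]] := spec_valP s UP.
have [V' [a' [f' [VP' VU' e']]]] := spec_valP t UP.
exists (ocap V V'), (a * f' + a' * f), (f * f'); split=> //.
  by move=> Q [/VU].
move=> Q UQ [VQ VQ']; have [Qf ->] := e Q UQ VQ; have [Qf' ->] := e' Q UQ VQ'.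
by exists (Localization.mulP Qf Qf'); rewrite -Localization.mkD.
Qed.

Lemma lf_mul (s t : spec_sect U) :
  locally_fraction (fun P (UP : U P) => s P UP * t P UP).
Proof.
move=> P UP; have [V [a [f [VP VU e]]]] := spec_valP s UP.
have [V' [a' [f' [VP' VU' e']]]] := spec_valP t UP.
exists (ocap V V'), (a * a'), (f * f'); split=> //.
  by move=> Q [/VU].
move=> Q UQ [VQ VQ']; have [Qf ->] := e Q UQ VQ; have [Qf' ->] := e' Q UQ VQ'.
by exists (Localization.mulP Qf Qf'); rewrite -Localization.mkM.
Qed.

Definition ss_add s t : spec_sect U := SpecSect (lf_add s t).
Definition ss_opp s : spec_sect U := SpecSect (lf_opp s).
Definition ss_mul s t : spec_sect U := SpecSect (lf_mul s t).
Definition ss_const a : spec_sect U := SpecSect (lf_const a).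

Lemma ss_addA : associative ss_add.
Proof. by move=> s t u; apply: spec_sect_ext => P UP; apply: addrA. Qed.
Lemma ss_addC : commutative ss_add.
Proof. by move=> s t; apply: spec_sect_ext => P UP; apply: addrC. Qed.
Lemma ss_add0 : left_id (ss_const 0) ss_add.
Proof. by move=> s; apply: spec_sect_ext => P UP; apply: add0r. Qed.
Lemma ss_addN : left_inverse (ss_const 0) ss_opp ss_add.
Proof. by move=> s; apply: spec_sect_ext => P UP; apply: addNr. Qed.
Lemma ss_mulA : associative ss_mul.
Proof. by move=> s t u; apply: spec_sect_ext => P UP; apply: mulrA. Qed.
Lemma ss_mulC : commutative ss_mul.
Proof. by move=> s t; apply: spec_sect_ext => P UP; apply: mulrC. Qed.
Lemma ss_mul1 : left_id (ss_const 1) ss_mul.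
Proof. by move=> s; apply: spec_sect_ext => P UP; apply: mul1r. Qed.
Lemma ss_mulDl : left_distributive ss_mul ss_add.
Proof. by move=> s t u; apply: spec_sect_ext => P UP; apply: mulrDl. Qed.

HB.instance Definition _ :=
  GRing.isZmodule.Build (spec_sect U) ss_addA ss_addC ss_add0 ss_addN.
HB.instance Definition _ :=
  GRing.Zmodule_isComPzRing.Build (spec_sect U) ss_mulA ss_mulC ss_mul1 ss_mulDl.

End StructureSheaf.

Section StructureSheafRestriction.
Variables (A : comPzRingType) (U V : opens (prime_ideal A)) (VU : V `<=o` U).

Lemma lf_res (s : spec_sect U) :
  locally_fraction (fun P (VP : V P) => s P (VU VP)).
Proof.
move=> P VP; have [W [a [f [WP WU e]]]] := spec_valP s (VU VP).
exists (ocap V W), a, f; split=> //; first by move=> Q [].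
by move=> Q VQ [_ WQ]; apply: e.
Qed.

Definition ss_res s : spec_sect V := SpecSect (lf_res s).

Lemma ss_res_nmod : nmod_morphism ss_res.
Proof. by split=> [|s t]; apply: spec_sect_ext. Qed.
Lemma ss_res_monoid : monoid_morphism ss_res.
Proof. by split=> [|s t]; apply: spec_sect_ext. Qed.
HB.instance Definition _ :=
  GRing.isNmodMorphism.Build (spec_sect U) (spec_sect V) ss_res ss_res_nmod.
HB.instance Definition _ :=
  GRing.isMonoidMorphism.Build (spec_sect U) (spec_sect V) ss_res ss_res_monoid.

End StructureSheafRestriction.

Section Spec.
Variable A : comPzRingType.

Program Definition spec : ringed_space :=
  @RingedSpace (prime_ideal A) (fun U => spec_sect U)
    (fun U V (VU : V `<=o` U) => ss_res VU) _ _.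
Next Obligation.
move=> U h s; apply: spec_sect_ext => P UP /=.
by congr (spec_val s _); apply: Prop_irrelevance.
Qed.
Next Obligation.
move=> U V W h h' h'' s; apply: spec_sect_ext => P UP /=.
by congr (spec_val s _); apply: Prop_irrelevance.
Qed.

Lemma spec_germ_unit (P : spec) (U : opens spec) (s : spec_sect U) (UP : U P) :
  @germ_unit spec P U s <-> exists x, s P UP * x = 1.
Proof.
split.
  move=> [W [h [WP [t e]]]]; exists (spec_val t WP).
  have /(congr1 (fun r : spec_sect W => spec_val r WP)) /= := e.
  by rewrite (_ : h P WP = UP) //; apply: Prop_irrelevance.
move=> [x e].
have [V [a [f [VP VU ef]]]] := spec_valP s UP.
have [Pf es] := ef P UP VP.
have [b [g [Pg ex]]] := Localization.mk_surj x.
move: e; rewrite es ex => e.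
have Pa : ~ P a.
  move=> Pa; move: e; rewrite -[_ * _]/(Localization.mul _ _) Localization.mkM.
  move=> /Localization.mk_eq[u Pu]; rewrite mulr1 mul1r => e.
  have : P (u * (f * g)) by rewrite -e; apply: psetM; rewrite mulrC; apply: psetM.
  by move=> /pset_prime[|/pset_prime[]].
have oD : open [set Q : prime_ideal A | ~ Q a].
  exists (fun c => c = a); apply/seteqP; split=> Q /=; first by exists a.
  by case=> _ ->.
pose W := ocap V (Opens oD).
have WU : W `<=o` U by move=> Q [/VU].
exists W, WU; split=> //.
pose t Q (WQ : W Q) : localization Q := Localization.mk f WQ.2.
have tP : locally_fraction t.
  move=> Q WQ; exists W, f, a; split=> // R WR WR'; exists WR.2.
  by [].
exists (SpecSect tP); apply: spec_sect_ext => Q WQ /=.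
have [Qf ->] := ef Q (WU Q WQ) WQ.1.
rewrite -[_ * _]/(Localization.mul _ _) Localization.mkM.
by apply: Localization.mkE; rewrite mulr1 mul1r mulrC.
Qed.

Lemma spec_local : local_stalks spec.
Proof.
move=> P U UP; split.
  move=> /(spec_germ_unit _ UP)[x]; rewrite mul0r => /esym.
  rewrite -[1]/(Localization.one P) -[0]/(Localization.zero P).
  move=> /Localization.mk_eq[u Pu]; rewrite !mulr1 mulr0 => e.
  by apply: Pu; rewrite e; apply: pset0.
move=> s t /(spec_germ_unit _ UP)[x].
have [a [f [Pf /= es]]] := Localization.mk_surj (spec_val s UP).
have [b [g [Pg et]]] := Localization.mk_surj (spec_val t UP).
have [c [h [Ph ->]]] := Localization.mk_surj x.
rewrite es et -[_ + _]/(Localization.add _ _) Localization.mkD.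
rewrite -[_ * _]/(Localization.mul _ _) Localization.mkM.
move=> /Localization.mk_eq[u Pu]; rewrite mulr1 mul1r => e.
have unit d k (Pk : ~ P k) (r : spec_sect U) :
    spec_val r UP = Localization.mk d Pk -> ~ P d -> @germ_unit spec P U r.
  move=> er Pd; apply/(spec_germ_unit _ UP); exists (Localization.mk k Pd).
  rewrite er -[_ * _]/(Localization.mul _ _) Localization.mkM.
  by apply: Localization.mkE; rewrite mulr1 mul1r mulrC.
have [Pa|Pa] := pselect (P a); last by left; apply: unit es Pa.
have [Pb|Pb] := pselect (P b); last by right; apply: unit et Pb.
exfalso.
have : P (u * (f * g * h)).
  rewrite -e; apply: psetM; rewrite mulrC; apply: psetM.
  by apply: psetD; rewrite mulrC; apply: psetM.
by move=> /pset_prime[//|/pset_prime[/pset_prime[]|]].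
Qed.

Lemma spec_sheaf : is_sheaf spec.
Proof.
move=> I V U UV cov s glue.
have [i_ i_P] : {i_ : forall P, V P -> I | forall P VP, U (i_ P VP) P}.
  have H : forall x : {P | V P}, exists i, U i (projT1 x).
    by case=> P VP; exact: cov.
  have [f fP] := boolp.choice H.
  by exists (fun P VP => f (exist _ P VP)) => P VP; exact: (fP (exist _ P VP)).
have ov P i j (Ui : U i P) (Uj : U j P) : spec_val (s i) Ui = spec_val (s j) Uj.
  have h1 : ocap (U i) (U j) `<=o` U i by move=> Q [].
  have h2 : ocap (U i) (U j) `<=o` U j by move=> Q [].
  have /(congr1 (fun r : spec_sect (ocap (U i) (U j)) =>
    @spec_val _ _ r P (conj Ui Uj))) /= :=
    glue i j _ h1 h2.
  rewrite (_ : h1 P _ = Ui); last exact: Prop_irrelevance.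
  by rewrite (_ : h2 P _ = Uj) //; exact: Prop_irrelevance.
pose t P (VP : V P) := spec_val (s (i_ P VP)) (i_P P VP).
have tP : locally_fraction t.
  move=> P VP; have [W [a [f [WP WU e]]]] := spec_valP (s _) (i_P P VP).
  exists W, a, f; split=> //; first by move=> Q /WU /UV.
  move=> Q VQ WQ; have [Qf e'] := e Q (WU Q WQ) WQ; exists Qf.
  by rewrite -e'; apply: ov.
exists (SpecSect tP); split.
  by move=> i; apply: spec_sect_ext => P UP /=; apply: ov.
move=> r rP; apply: spec_sect_ext => P VP /=.
rewrite /t -rP /=; congr (spec_val r _); exact: Prop_irrelevance.
Qed.

End Spec.

Definition is_scheme (X : ringed_space) : Prop :=
  [/\ is_sheaf X, local_stalks X &
      forall x : X, exists (A : comPzRingType) (j : lrs_mor (spec A) X),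
        open_immersion j /\ range j x].

Lemma spec_scheme (A : comPzRingType) : is_scheme (spec A).
Proof.
split; [exact: spec_sheaf|exact: spec_local|move=> P].
exists A, (lrs_id (spec A)); split; last by exists P.
split=> [//|U oU|V _]; first by rewrite image_id.
have h : V `<=o` opre (mcont (lrs_id (spec A))) V by [].
by exists (res h) => s; apply: resK.
Qed.

Section LocalizationMore.
Variables (A : comPzRingType) (P : prime_ideal A).

Lemma locM a s (Ps : ~ P s) b t (Pt : ~ P t) :
  Localization.mk a Ps * Localization.mk b Pt =
  Localization.mk (a * b) (Localization.mulP Ps Pt).
Proof. exact: Localization.mkM. Qed.

Lemma locD a s (Ps : ~ P s) b t (Pt : ~ P t) :
  Localization.mk a Ps + Localization.mk b Pt =
  Localization.mk (a * t + b * s) (Localization.mulP Ps Pt).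
Proof. exact: Localization.mkD. Qed.

Lemma loc_unit a s (Ps : ~ P s) :
  (exists x, Localization.mk a Ps * x = 1) <-> ~ P a.
Proof.
split=> [[x] + Pa|Pa].
  have [b [t [Pt ->]]] := Localization.mk_surj x.
  rewrite locM => /Localization.mk_eq[u Pu]; rewrite mulr1 mul1r => e.
  have : P (u * (s * t)).
    by rewrite -e; apply: psetM; rewrite mulrC; apply: psetM.
  by move=> /pset_prime[|/pset_prime[]].
exists (Localization.mk s Pa); rewrite locM.
by apply: Localization.mkE; rewrite mulr1 mul1r mulrC.
Qed.

Lemma notinX s n : ~ P s -> ~ P (s ^+ n).
Proof.
move=> Ps; elim: n => [|n IHn]; first exact: pset1.
by rewrite exprS => /pset_prime[].
Qed.

Lemma psetX a n : (0 < n)%N -> P a -> P (a ^+ n).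
Proof. by case: n => // n _ Pa; rewrite exprSr; apply: psetM. Qed.

Lemma locX a s (Ps : ~ P s) n (Psn : ~ P (s ^+ n)) :
  Localization.mk a Ps ^+ n = Localization.mk (a ^+ n) Psn.
Proof.
elim: n Psn => [|n IHn] Psn; first by apply: Localization.mkE; rewrite !expr0.
rewrite exprS (IHn (notinX Ps)) locM.
by apply: Localization.mkE; rewrite !exprS.
Qed.

End LocalizationMore.

Section SpecMap.
Variables (A B : comPzRingType) (phi : {rmorphism A -> B}).

Program Definition prime_preim (Q : prime_ideal B) : prime_ideal A :=
  @PrimeIdeal A (fun a => Q (phi a)) _ _ _ _ _.
Next Obligation. by move=> Q /=; rewrite rmorph0; apply: pset0. Qed.
Next Obligation. by move=> Q a b ? ? /=; rewrite rmorphD; apply: psetD. Qed.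
Next Obligation. by move=> Q a b ? /=; rewrite rmorphM; apply: psetM. Qed.
Next Obligation. by move=> Q /=; rewrite rmorph1; apply: pset1. Qed.
Next Obligation. by move=> Q a b /=; rewrite rmorphM => /pset_prime. Qed.

Lemma prime_preim_cont : continuous (prime_preim : spec B -> spec A).
Proof.
apply/continuousP => _ [S ->].
exists (fun b => exists2 a, S a & b = phi a).
apply/seteqP; split=> Q /=; first by case=> a Sa Qa; exists (phi a) => //; exists a.
by case=> _ [a Sa ->] Qa; exists a.
Qed.

Definition loc_map (Q : prime_ideal B) (x : localization (prime_preim Q)) :
  localization Q :=
  Localization.mk (P := Q) (phi (Localization.nm x)) (@Localization.dnP _ _ x).

Lemma loc_mapE Q a f (Qf : ~ prime_preim Q f) (Qf' : ~ Q (phi f)) :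
  loc_map (Localization.mk a Qf) = Localization.mk (phi a) Qf'.
Proof.
have /Localization.mk_eq[u Pu e] := Localization.reprE (Localization.mk a Qf).
apply/Localization.mk_eq; exists (phi u) => //.
by rewrite -!rmorphM e.
Qed.

Lemma loc_map_nmod Q : nmod_morphism (@loc_map Q).
Proof.
split=> [|x y].
  rewrite -[0]/(Localization.zero _) loc_mapE.
    by rewrite rmorph1; exact: pset1.
  by move=> Q1; apply: Localization.mkE; rewrite rmorph0 !mul0r.
have [a [f [Qf ->]]] := Localization.mk_surj x.
have [b [g [Qg ->]]] := Localization.mk_surj y.
rewrite locD !loc_mapE; first by rewrite rmorphM; exact: Localization.mulP.
by move=> h; rewrite locD; apply: Localization.mkE; rewrite rmorphD !rmorphM.
Qed.

Lemma loc_map_monoid Q : monoid_morphism (@loc_map Q).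
Proof.
split=> [|x y].
  rewrite -[1]/(Localization.one _) loc_mapE.
    by rewrite rmorph1; exact: pset1.
  by move=> Q1; apply: Localization.mkE; rewrite rmorph1.
have [a [f [Qf ->]]] := Localization.mk_surj x.
have [b [g [Qg ->]]] := Localization.mk_surj y.
rewrite locM !loc_mapE; first by rewrite rmorphM; exact: Localization.mulP.
by move=> h; rewrite locM; apply: Localization.mkE; rewrite !rmorphM.
Qed.

HB.instance Definition _ Q := GRing.isNmodMorphism.Build
  (localization (prime_preim Q)) (localization Q) (@loc_map Q) (loc_map_nmod Q).
HB.instance Definition _ Q := GRing.isMonoidMorphism.Build
  (localization (prime_preim Q)) (localization Q) (@loc_map Q) (loc_map_monoid Q).

Section Comap.
Variable V : opens (spec A).

Lemma spec_comap_lf (s : spec_sect V) :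
  @locally_fraction B (opre prime_preim_cont V)
    (fun Q (VQ : V (prime_preim Q)) => loc_map (spec_val s VQ)).
Proof.
move=> Q VQ; have [W [a [f [WQ WV e]]]] := spec_valP s VQ.
exists (opre prime_preim_cont W), (phi a), (phi f); split=> //.
  by move=> R; apply: WV.
move=> R VR WR; have [Rf ->] := e _ VR WR.
by exists Rf; apply: loc_mapE.
Qed.

Definition spec_comap (s : spec_sect V) : spec_sect (opre prime_preim_cont V) :=
  SpecSect (spec_comap_lf s).

Lemma spec_comap_nmod : nmod_morphism spec_comap.
Proof.
split=> [|s t]; apply: spec_sect_ext => Q VQ /=; first exact: rmorph0.
exact: rmorphD.
Qed.
Lemma spec_comap_monoid : monoid_morphism spec_comap.
Proof.
split=> [|s t]; apply: spec_sect_ext => Q VQ /=; first exact: rmorph1.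
exact: rmorphM.
Qed.
HB.instance Definition _ := GRing.isNmodMorphism.Build
  (spec_sect V) (spec_sect (opre prime_preim_cont V)) spec_comap spec_comap_nmod.
HB.instance Definition _ := GRing.isMonoidMorphism.Build
  (spec_sect V) (spec_sect (opre prime_preim_cont V)) spec_comap spec_comap_monoid.
End Comap.

Program Definition spec_map : lrs_mor (spec B) (spec A) :=
  @LrsMor (spec B) (spec A) prime_preim prime_preim_cont
    (fun V => spec_comap (V := V)) _ _.
Next Obligation.
move=> V W h h' s; apply: spec_sect_ext => Q WQ /=.
by congr (loc_map (spec_val s _)); apply: Prop_irrelevance.
Qed.
Next Obligation.
move=> Q V s VQ.
move=> /(@spec_germ_unit B Q (opre prime_preim_cont V) (spec_comap s) VQ)[x] /= e.
apply/(@spec_germ_unit A _ _ _ VQ); move: x e.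
have [a [f [Qf ->]]] := Localization.mk_surj (spec_val s VQ).
rewrite loc_mapE => x e; apply/loc_unit.
by have /loc_unit : exists x, Localization.mk (P := Q) (phi a) Qf * x = 1 by exists x.
Qed.

End SpecMap.

Record scheme (p : nat) := Scheme {
  sch_space :> ringed_space;
  schP : is_scheme sch_space;
  sch_char : forall U : opens sch_space, p%:R = 0 :> sect U }.

Lemma frobD (p : nat) (R : comPzRingType) (x y : R) :
  prime p -> p%:R = 0 :> R -> (x + y) ^+ p = x ^+ p + y ^+ p.
Proof.
case: p => [//|p] pp charR.
rewrite exprDn big_ord_recl big_ord_recr /= big1 => [|i _].
  rewrite subn0 expr0 mulr1 bin0 mulr1n add0r /bump leq0n add1n subnn expr0.
  by rewrite mul1r binn mulr1n.
have /dvdnP[k ->] : (p.+1 %| 'C(p.+1, bump 0 i))%N.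
  by apply: prime_dvd_bin => //; rewrite /bump /= add1n ltnS ltn_ord.
by rewrite mulrnA -mulr_natr charR mulr0.
Qed.

Section FrobeniusRing.
Variables (p : nat) (pp : prime p) (R : comPzRingType).
Hypothesis charR : p%:R = 0 :> R.

(* The arguments only serve to attach the ring morphism structure. *)
Definition frob of prime p & p%:R = 0 :> R := fun x : R => x ^+ p.

Lemma frob_nmod : nmod_morphism (frob pp charR).
Proof.
split=> [|x y]; first by rewrite /frob expr0n -[p]prednK ?prime_gt0.
exact: frobD.
Qed.

Lemma frob_monoid : monoid_morphism (frob pp charR).
Proof. by split=> [|x y]; rewrite /frob ?expr1n ?exprMn. Qed.

HB.instance Definition _ :=
  GRing.isNmodMorphism.Build R R (frob pp charR) frob_nmod.
HB.instance Definition _ :=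
  GRing.isMonoidMorphism.Build R R (frob pp charR) frob_monoid.

End FrobeniusRing.

Section Frobenius.
Variables (p : nat) (pp : prime p) (X : scheme p).

Program Definition frobenius : lrs_mor X X :=
  @LrsMor X X idfun (fun x => @cvg_id _ (nbhs x))
    (fun V => res (@id_pre X V) \o frob pp (sch_char V)) _ _.
Next Obligation.
move=> V W h h' s /=; rewrite /frob !rmorphXn.
by rewrite !(res_res _ _ (res_sub h' (@id_pre _ V))).
Qed.
Next Obligation.
move=> x V s Vx /germ_unit_res -/(_ Vx) [W [h [Wx [t]]]].
rewrite /= /frob rmorphXn => e.
exists W, h; split=> //; exists (res h s ^+ p.-1 * t).
by rewrite mulrA -exprS prednK ?prime_gt0.
Qed.

End Frobenius.

Record twisted_scheme (p : nat) (pp : prime p) := TwistedScheme {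
  ts_scheme :> scheme p;
  ts_phi : lrs_mor ts_scheme ts_scheme;
  ts_phi2 : lrs_comp ts_phi ts_phi = frobenius pp ts_scheme }.

Section TwistedSchemes.
Variables (p : nat) (pp : prime p).
Implicit Types X Y Z : twisted_scheme pp.

Record twisted_mor X Y := TwistedMor {
  tm_mor :> lrs_mor X Y;
  tm_comm : lrs_comp (ts_phi Y) tm_mor = lrs_comp tm_mor (ts_phi X) }.

HB.instance Definition _ X Y := gen_eqMixin (twisted_mor X Y).
HB.instance Definition _ X Y := gen_choiceMixin (twisted_mor X Y).

Program Definition tm_comp X Y Z (g : twisted_mor Y Z) (f : twisted_mor X Y) :
  twisted_mor X Z := @TwistedMor X Z (lrs_comp g f) _.
Next Obligation.
by move=> X Y Z g f; rewrite lrs_compA tm_comm -lrs_compA tm_comm lrs_compA.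
Qed.

(* A group object: a group structure on the sets of morphisms to [tg_scheme],
   natural in the source. *)
Record twisted_group_scheme := TwistedGroupScheme {
  tg_scheme :> twisted_scheme pp;
  tg_mul : forall T, twisted_mor T tg_scheme -> twisted_mor T tg_scheme ->
    twisted_mor T tg_scheme;
  tg_one : forall T, twisted_mor T tg_scheme;
  tg_inv : forall T, twisted_mor T tg_scheme -> twisted_mor T tg_scheme;
  tg_mulA : forall T, associative (@tg_mul T);
  tg_mul1g : forall T, left_id (tg_one T) (@tg_mul T);
  tg_mulg1 : forall T, right_id (tg_one T) (@tg_mul T);
  tg_mulVg : forall T, left_inverse (tg_one T) (@tg_inv T) (@tg_mul T);
  tg_mulgV : forall T, right_inverse (tg_one T) (@tg_inv T) (@tg_mul T);
  tg_nat : forall T S (h : twisted_mor S T) (x y : twisted_mor T tg_scheme),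
    tm_comp (tg_mul x y) h = tg_mul (tm_comp x h) (tm_comp y h) }.

Definition tg_points (G : twisted_group_scheme) (T : twisted_scheme pp) : Type :=
  twisted_mor T G.

HB.instance Definition _ G T := Choice.copy (tg_points G T) (twisted_mor T G).
HB.instance Definition _ G T := isGroup.Build (tg_points G T)
  (@tg_mulA G T) (@tg_mul1g G T) (@tg_mulg1 G T)
  (@tg_mulVg G T) (@tg_mulgV G T).

End TwistedSchemes.

Record blended_field (p : nat) := BlendedField {
  bf_field :> fieldType;
  bf_char : p \in [pchar bf_field];
  bf_psi : {rmorphism bf_field -> bf_field};
  bf_psi2 : forall x, bf_psi (bf_psi x) = x ^+ p }.

Section SpecBlended.
Variables (p : nat) (pp : prime p) (b : blended_field p).

Lemma spec_blended_char (U : opens (spec b)) : p%:R = 0 :> spec_sect U.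
Proof.
apply: spec_sect_ext => P UP.
have e : ss_const U (0 : b) = 0 by [].
have cn n : ss_const U (n%:R : b) = n%:R.
  elim: n => [//|n IHn]; rewrite -natr1 -[in RHS]natr1 -IHn.
  apply: spec_sect_ext => Q UQ /=; rewrite locD.
  by apply: Localization.mkE; rewrite !mulr1.
by rewrite -cn (pcharf0 (bf_char b)).
Qed.

Definition spec_scheme_blended : scheme p :=
  Scheme (spec_scheme b) spec_blended_char.

Program Definition spec_blended : twisted_scheme pp :=
  @TwistedScheme p pp spec_scheme_blended (spec_map (bf_psi b)) _.
Next Obligation.
have psiE (Q : prime_ideal b) a :
    prime_preim (bf_psi b) (prime_preim (bf_psi b) Q) a <-> Q a.
  rewrite /= bf_psi2; split=> [Qa|Qa]; last first.
    exact/psetX/Qa/prime_gt0.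
  by apply: contrapT => nQa; exact: notinX nQa Qa.
have psi2 (Q : prime_ideal b) :
    prime_preim (bf_psi b) (prime_preim (bf_psi b) Q) = Q.
  by apply: prime_ideal_ext => a; apply: psiE.
apply: lrs_mor_ext => [Q|V s W hf hg]; first exact: psi2.
apply: spec_sect_ext => Q WQ.
have VQ : V Q := hg Q WQ.
have [N [a [f [NQ NV e]]]] := spec_valP s VQ.
have NQ' : N (prime_preim (bf_psi b) (prime_preim (bf_psi b) Q)) by rewrite psi2.
have [Qf ef] := e Q (hg Q WQ) NQ.
have [Qf' ef'] := e _ (hf Q WQ) NQ'.
have valX n : spec_val (s ^+ n : spec_sect V) VQ = spec_val s VQ ^+ n.
  elim: n => [//|n IHn].
  by rewrite !exprS -IHn.
have eVQ (h : V Q) : h = VQ by apply: Prop_irrelevance.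
have Qfp : ~ Q (f ^+ p) by apply: notinX.
transitivity (Localization.mk (a ^+ p) Qfp).
  transitivity (@loc_map _ _ (bf_psi b) Q (loc_map (Localization.mk a Qf'))).
    rewrite -ef' /=; congr (loc_map (loc_map (spec_val s _))).
    exact: Prop_irrelevance.
  have h1 : ~ prime_preim (bf_psi b) Q (bf_psi b f) := Qf'.
  have h2 : ~ Q (bf_psi b (bf_psi b f)) := Qf'.
  rewrite (@loc_mapE _ _ _ (prime_preim (bf_psi b) Q) a f Qf' h1) (loc_mapE _ _ h2).
  by apply: Localization.mkE; rewrite !bf_psi2.
by rewrite /= (eVQ (id_pre _)) /frob valX -(eVQ (hg Q WQ)) ef (locX a Qf Qfp).
Qed.
End SpecBlended.

(* A commutative [B]-algebra is a ring with a ring morphism from [B]; unlike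
   [comAlgType B], this allows restriction of scalars and the zero ring. *)
Record alg (B : comPzRingType) := Alg {
  alg_ring :> comPzRingType;
  alg_str : {rmorphism B -> alg_ring} }.
Arguments Alg {B alg_ring} alg_str.

Section AlgHom.
Variable B : comPzRingType.
Implicit Types R S T : alg B.

Record alg_hom R S := AlgHom {
  ah_mor :> {rmorphism R -> S};
  ah_str : forall b : B, ah_mor (alg_str R b) = alg_str S b }.

HB.instance Definition _ R S := gen_eqMixin (alg_hom R S).
HB.instance Definition _ R S := gen_choiceMixin (alg_hom R S).

Lemma alg_hom_ext R S (f g : alg_hom R S) : f =1 g -> f = g.
Proof.
case: f g => f hf [g hg] /= /eq_rmorphism e; subst g.
by congr AlgHom; apply: Prop_irrelevance.
Qed.

Definition ah_id R : alg_hom R R :=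
  @AlgHom R R (idfun : {rmorphism R -> R}) (fun b => erefl).

Program Definition ah_comp R S T (g : alg_hom S T) (f : alg_hom R S) :
  alg_hom R T := @AlgHom R T (g \o f : {rmorphism R -> T}) _.
Next Obligation. by move=> R S T g f b /=; rewrite !ah_str. Qed.

Definition base_alg : alg B := Alg (idfun : {rmorphism B -> B}).

Definition ah_init R : alg_hom base_alg R :=
  @AlgHom base_alg R (alg_str R) (fun b => erefl).

End AlgHom.

Record group_functor (B : comPzRingType) := GroupFunctor {
  gf :> alg B -> groupType;
  gmap : forall R S : alg B, alg_hom R S -> gf R -> gf S;
  gmapM : forall (R S : alg B) (h : alg_hom R S) (x y : gf R),
    gmap h (x * y)%g = (gmap h x * gmap h y)%g;
  gmap_id : forall (R : alg B) (x : gf R), gmap (ah_id R) x = x;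
  gmap_comp : forall (R S T : alg B) (h : alg_hom S T) (h' : alg_hom R S)
    (x : gf R), gmap (ah_comp h h') x = gmap h (gmap h' x) }.

Record gf_hom (B : comPzRingType) (H G : group_functor B) := GfHom {
  gh :> forall R : alg B, H R -> G R;
  ghM : forall (R : alg B) (x y : H R), gh (x * y)%g = (gh x * gh y)%g;
  gh_nat : forall (R S : alg B) (h : alg_hom R S) (x : H R),
    gh (gmap h x) = gmap h (gh x) }.

(* An affine group over [B]: a [B]-algebra with a group structure on its
   functor of points. *)
Record affine_group (B : comPzRingType) := AffineGroup {
  coord : alg B;
  ag_mul : forall R : alg B, alg_hom coord R -> alg_hom coord R ->
    alg_hom coord R;
  ag_one : forall R : alg B, alg_hom coord R;
  ag_inv : forall R : alg B, alg_hom coord R -> alg_hom coord R;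
  ag_mulA : forall R : alg B, associative (@ag_mul R);
  ag_mul1g : forall R : alg B, left_id (ag_one R) (@ag_mul R);
  ag_mulg1 : forall R : alg B, right_id (ag_one R) (@ag_mul R);
  ag_mulVg : forall R : alg B,
    left_inverse (ag_one R) (@ag_inv R) (@ag_mul R);
  ag_mulgV : forall R : alg B,
    right_inverse (ag_one R) (@ag_inv R) (@ag_mul R);
  ag_nat : forall (R S : alg B) (h : alg_hom R S) (x y : alg_hom coord R),
    ah_comp h (ag_mul x y) = ag_mul (ah_comp h x) (ah_comp h y) }.

Section AffineGroupFunctor.
Variables (B : comPzRingType) (G : affine_group B).

Definition ag_points (R : alg B) : Type := alg_hom (coord G) R.

HB.instance Definition _ R := Choice.copy (ag_points R) (alg_hom (coord G) R).
HB.instance Definition _ R := isGroup.Build (ag_points R)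
  (@ag_mulA _ G R) (@ag_mul1g _ G R) (@ag_mulg1 _ G R)
  (@ag_mulVg _ G R) (@ag_mulgV _ G R).

Program Definition ag_functor : group_functor B :=
  @GroupFunctor B (fun R => ag_points R)
    (fun R S h x => ah_comp h (x : alg_hom (coord G) R)) _ _ _.
Next Obligation. by move=> R S h x y; apply: ag_nat. Qed.
Next Obligation. by move=> R x; apply: alg_hom_ext. Qed.
Next Obligation. by move=> R S T h h' x; apply: alg_hom_ext. Qed.

End AffineGroupFunctor.
Coercion ag_functor : affine_group >-> group_functor.

Program Definition Ga (B : comPzRingType) : group_functor B :=
  @GroupFunctor B (fun R => Algebra.to_multiplicative R) (fun R S h x => h x) _ _ _.
Next Obligation. by move=> B R S h x y; apply: (rmorphD h). Qed.
Next Obligation. by []. Qed.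
Next Obligation. by []. Qed.

(* An [n]-tuple of units of [R], with the inverses. *)
Record torus_points (n : nat) (R : comPzRingType) := TorusPoint {
  tval : 'I_n -> R;
  tinv : 'I_n -> R;
  tvalK : forall i, tval i * tinv i = 1 }.

Section TorusPoints.
Variables (n : nat) (R : comPzRingType).

HB.instance Definition _ := gen_eqMixin (torus_points n R).
HB.instance Definition _ := gen_choiceMixin (torus_points n R).

Lemma torus_ext (t u : torus_points n R) : tval t =1 tval u -> t = u.
Proof.
case: t u => t t' tK [u u' uK] /= /funext e; subst u.
have {}e : t' = u'.
  apply/funext => i; rewrite -[t' i]mulr1 -(uK i) mulrCA mulrA -[RHS]mul1r.
  by rewrite tK.
by subst u'; congr TorusPoint; apply: Prop_irrelevance.
Qed.

Program Definition torus_mul (t u : torus_points n R) : torus_points n R :=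
  @TorusPoint n R (fun i => tval t i * tval u i) (fun i => tinv t i * tinv u i) _.
Next Obligation. by move=> t u i; rewrite mulrACA !tvalK mulr1. Qed.
Definition torus_one : torus_points n R :=
  @TorusPoint n R (fun _ => 1) (fun _ => 1) (fun _ => mulr1 1).
Program Definition torus_inv (t : torus_points n R) : torus_points n R :=
  @TorusPoint n R (tinv t) (tval t) _.
Next Obligation. by move=> t i; rewrite mulrC tvalK. Qed.

Lemma torus_mulA : associative torus_mul.
Proof. by move=> t u v; apply: torus_ext => i /=; rewrite mulrA. Qed.
Lemma torus_mul1g : left_id torus_one torus_mul.
Proof. by move=> t; apply: torus_ext => i /=; rewrite mul1r. Qed.
Lemma torus_mulg1 : right_id torus_one torus_mul.
Proof. by move=> t; apply: torus_ext => i /=; rewrite mulr1. Qed.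
Lemma torus_mulVg : left_inverse torus_one torus_inv torus_mul.
Proof. by move=> t; apply: torus_ext => i /=; rewrite mulrC tvalK. Qed.
Lemma torus_mulgV : right_inverse torus_one torus_inv torus_mul.
Proof. by move=> t; apply: torus_ext => i /=; rewrite tvalK. Qed.

HB.instance Definition _ := isGroup.Build (torus_points n R)
  torus_mulA torus_mul1g torus_mulg1 torus_mulVg torus_mulgV.

(* Characters of the torus are integer vectors. *)
Definition character (r : 'rV[int]_n) (t : torus_points n R) : R :=
  \prod_i match r 0 i with
          | Posz m => tval t i ^+ m
          | Negz m => tinv t i ^+ m.+1
          end.

End TorusPoints.

Program Definition torus_map (n : nat) (R S : comPzRingType)
  (h : {rmorphism R -> S}) (t : torus_points n R) : torus_points n S :=
  @TorusPoint n S (fun i => h (tval t i)) (fun i => h (tinv t i)) _.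
Next Obligation. by move=> n R S h t i; rewrite -rmorphM tvalK rmorph1. Qed.

Program Definition torus (n : nat) (B : comPzRingType) : group_functor B :=
  @GroupFunctor B (fun R => torus_points n R)
    (fun R S h t => torus_map h t) _ _ _.
Next Obligation.
by move=> n B R S h t u; apply: torus_ext => i; apply: (rmorphM h).
Qed.
Next Obligation. by move=> n B R t; apply: torus_ext. Qed.
Next Obligation. by move=> n B R S T h h' t; apply: torus_ext. Qed.

Section BaseChange.
Variables (B K : comPzRingType) (iota : {rmorphism B -> K}).

Definition restrict (R : alg K) : alg B :=
  Alg (alg_str R \o iota : {rmorphism B -> R}).

Definition restrict_hom (R S : alg K) (h : alg_hom R S) :
  alg_hom (restrict R) (restrict S) :=
  @AlgHom B (restrict R) (restrict S) h (fun b => ah_str h (iota b)).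

Program Definition base_change (G : group_functor B) : group_functor K :=
  @GroupFunctor K (fun R => G (restrict R))
    (fun R S h => gmap (g := G) (restrict_hom h)) _ _ _.
Next Obligation. by move=> G R S h x y; apply: gmapM. Qed.
Next Obligation.
move=> G R x; rewrite -[RHS]gmap_id; congr (gmap _ _);
  by apply: alg_hom_ext.
Qed.
Next Obligation.
move=> G R S T h h' x; rewrite /= -gmap_comp; congr (gmap _ _);
  by apply: alg_hom_ext.
Qed.

End BaseChange.

(* [Dual a b] is a + b * epsilon with epsilon ^ 2 = 0. *)
Record dual (R : Type) := Dual { dre : R; deps : R }.

Section DualRing.
Variable R : comPzRingType.

HB.instance Definition _ := gen_eqMixin (dual R).
HB.instance Definition _ := gen_choiceMixin (dual R).

Definition dual_add (x y : dual R) := Dual (dre x + dre y) (deps x + deps y).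
Definition dual_opp (x : dual R) := Dual (- dre x) (- deps x).
Definition dual_mul (x y : dual R) :=
  Dual (dre x * dre y) (dre x * deps y + deps x * dre y).

Ltac dual := repeat case=> ? ?; rewrite /dual_add /dual_mul /dual_opp /=;
  congr Dual; ring.

Lemma dual_addA : associative dual_add. Proof. dual. Qed.
Lemma dual_addC : commutative dual_add. Proof. dual. Qed.
Lemma dual_add0 : left_id (Dual 0 0) dual_add. Proof. dual. Qed.
Lemma dual_addN : left_inverse (Dual 0 0) dual_opp dual_add. Proof. dual. Qed.
Lemma dual_mulA : associative dual_mul. Proof. dual. Qed.
Lemma dual_mulC : commutative dual_mul. Proof. dual. Qed.
Lemma dual_mul1 : left_id (Dual 1 0) dual_mul. Proof. dual. Qed.
Lemma dual_mulDl : left_distributive dual_mul dual_add. Proof. dual. Qed.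

HB.instance Definition _ :=
  GRing.isZmodule.Build (dual R) dual_addA dual_addC dual_add0 dual_addN.
HB.instance Definition _ := GRing.Zmodule_isComPzRing.Build (dual R)
  dual_mulA dual_mulC dual_mul1 dual_mulDl.

Definition dual_in (a : R) : dual R := Dual a 0.
Lemma dual_in_nmod : nmod_morphism dual_in.
Proof. by split=> // a b; congr Dual; rewrite addr0. Qed.
Lemma dual_in_monoid : monoid_morphism dual_in.
Proof. by split=> // a b; congr Dual; rewrite /= mulr0 mul0r addr0. Qed.
HB.instance Definition _ :=
  GRing.isNmodMorphism.Build R (dual R) dual_in dual_in_nmod.
HB.instance Definition _ :=
  GRing.isMonoidMorphism.Build R (dual R) dual_in dual_in_monoid.

Lemma dre_nmod : nmod_morphism (@dre R). Proof. by []. Qed.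
Lemma dre_monoid : monoid_morphism (@dre R). Proof. by []. Qed.
HB.instance Definition _ :=
  GRing.isNmodMorphism.Build (dual R) R (@dre R) dre_nmod.
HB.instance Definition _ :=
  GRing.isMonoidMorphism.Build (dual R) R (@dre R) dre_monoid.

(* epsilon |-> c * epsilon *)
Definition dual_scale (c : R) (x : dual R) : dual R := Dual (dre x) (c * deps x).
Lemma dual_scale_nmod c : nmod_morphism (dual_scale c).
Proof. by split=> [|x y]; congr Dual; rewrite /= ?mulr0 ?mulrDr. Qed.
Lemma dual_scale_monoid c : monoid_morphism (dual_scale c).
Proof. by split=> [|x y]; congr Dual; rewrite /= ?mulr0 //; ring. Qed.
HB.instance Definition _ c := GRing.isNmodMorphism.Build
  (dual R) (dual R) (dual_scale c) (dual_scale_nmod c).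
HB.instance Definition _ c := GRing.isMonoidMorphism.Build
  (dual R) (dual R) (dual_scale c) (dual_scale_monoid c).

End DualRing.

Section DualMap.
Variables (R S : comPzRingType) (h : {rmorphism R -> S}).
Definition dual_map (x : dual R) : dual S := Dual (h (dre x)) (h (deps x)).
Lemma dual_map_nmod : nmod_morphism dual_map.
Proof. by split=> [|x y]; congr Dual; rewrite /= ?rmorph0 ?rmorphD. Qed.
Lemma dual_map_monoid : monoid_morphism dual_map.
Proof.
by split=> [|x y]; congr Dual; rewrite /= ?rmorph1 ?rmorph0 ?rmorphD ?rmorphM.
Qed.
HB.instance Definition _ :=
  GRing.isNmodMorphism.Build (dual R) (dual S) dual_map dual_map_nmod.
HB.instance Definition _ :=
  GRing.isMonoidMorphism.Build (dual R) (dual S) dual_map dual_map_monoid.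
End DualMap.

Section Roots.
Variable B : comPzRingType.
Implicit Types R : alg B.

Definition dual_alg R : alg B :=
  Alg (@dual_in R \o alg_str R : {rmorphism B -> dual R}).

Definition ah_dual_in R : alg_hom R (dual_alg R) :=
  @AlgHom B R (dual_alg R) (@dual_in R) (fun b => erefl).
Definition ah_dre R : alg_hom (dual_alg R) R :=
  @AlgHom B (dual_alg R) R (@dre R) (fun b => erefl).
Program Definition ah_dual_scale R (c : R) :
  alg_hom (dual_alg R) (dual_alg R) :=
  @AlgHom B (dual_alg R) (dual_alg R) (dual_scale c) _.
Next Obligation. by move=> R c b; congr Dual; rewrite /= mulr0. Qed.
Program Definition ah_dual_map (R S : alg B) (h : alg_hom R S) :
  alg_hom (dual_alg R) (dual_alg S) :=
  @AlgHom B (dual_alg R) (dual_alg S) (dual_map h) _.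
Next Obligation. by move=> R S h b; congr Dual; rewrite /= ?ah_str ?rmorph0. Qed.

Variables (n : nat) (G : group_functor B) (tau : gf_hom (torus n B) G).

(* [v] lies in Lie(G)(B), the kernel of G(B[epsilon]) -> G(B). *)
Definition in_Lie (v : G (dual_alg (base_alg B))) : Prop :=
  gmap (ah_dre _) v = 1%g.

(* Ad(t) v = r(t) v in Lie(G)(R), for all R-points t of the torus. *)
Definition has_weight (r : 'rV[int]_n) (v : G (dual_alg (base_alg B))) : Prop :=
  forall (R : alg B) (t : torus n B R),
    let vR := gmap (ah_dual_map (ah_init R)) v in
    let tR := gmap (ah_dual_in R) (tau R t) in
    (tR * vR * tR^-1)%g = gmap (ah_dual_scale (character r t)) vR.

Definition is_root (r : 'rV[int]_n) : Prop :=
  r != 0 /\ exists v, [/\ in_Lie v, v <> 1%g & has_weight r v].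

End Roots.

Section GroupProperties.
Variables (B : comPzRingType) (G : affine_group B).

Definition of_finite_type : Prop :=
  exists s : seq (coord G), forall S : coord G -> Prop,
    (forall b : B, S (alg_str (coord G) b)) ->
    (forall x y, S x -> S y -> S (x + y)) ->
    (forall x y, S x -> S y -> S (x * y)) ->
    (forall x, x \in s -> S x) ->
    forall x, S x.

(* The infinitesimal lifting criterion. *)
Definition formally_smooth : Prop :=
  forall (R S : alg B) (pi : alg_hom R S),
    (forall y, exists x, pi x = y) ->
    (forall x y, pi x = 0 -> pi y = 0 -> x * y = 0) ->
    forall y : G S, exists x : G R, gmap pi x = y.

Definition connected_group : Prop := connected [set: spec (coord G)].

Definition closed_immersion (H : group_functor B) (f : gf_hom H G) : Prop :=
  (forall R : alg B, injective (f R)) /\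
  exists I : coord G -> Prop, forall (R : alg B) (x : alg_hom (coord G) R),
    (exists h : H R, f R h = x) <-> (forall a, I a -> x a = 0).

End GroupProperties.

(* The group of points over an algebraically closed [K], with the Zariski
   topology whose closed sets are the zero loci of sets of regular functions,
   i.e. of elements of the tensor product of [coord G] with [K]. *)
Section GeometricPoints.
Variables (B : comPzRingType) (G : affine_group B).
Variables (K : closedFieldType) (iota : {rmorphism B -> K}).

Definition geom_points : groupType := base_change iota G (base_alg K).

Definition regular_value (e : seq (K * coord G)) (x : geom_points) : K :=
  \sum_(ca <- e) ca.1 * (x : alg_hom (coord G) (restrict iota (base_alg K))) ca.2.

Definition zariski_closed (C : geom_points -> Prop) : Prop :=
  exists E : seq (K * coord G) -> Prop,
    forall x, C x <-> (forall e, E e -> regular_value e x = 0).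

Definition zariski_connected (C : geom_points -> Prop) : Prop :=
  forall C1 C2, zariski_closed C1 -> zariski_closed C2 ->
    (forall x, C x <-> C1 x \/ C2 x) -> (forall x, ~ (C1 x /\ C2 x)) ->
    (forall x, ~ C1 x) \/ (forall x, ~ C2 x).

End GeometricPoints.

Section AbstractGroups.
Variable X : groupType.
Implicit Types N : X -> Prop.

Definition is_subgroup N : Prop :=
  [/\ N 1%g, forall x y, N x -> N y -> N (x * y)%g & forall x, N x -> N x^-1%g].

Definition is_normal N : Prop := forall x y, N x -> N (x ^ y)%g.

(* There is a chain of subgroups of length [n] from [N] down to 1, each of
   which contains all commutators of elements of the previous one. *)
Fixpoint solvable_in (n : nat) N : Prop :=
  match n with
  | 0%N => forall x, N x -> x = 1%g
  | n.+1 => exists N', [/\ is_subgroup N', forall x, N' x -> N x,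
              forall x y, N x -> N y -> N' (x^-1 * y^-1 * x * y)%g &
              solvable_in n N']
  end.

Definition is_solvable N : Prop := exists n, solvable_in n N.

End AbstractGroups.

(* The radical of G over every algebraically closed field is trivial. *)
Definition semisimple (B : comPzRingType) (G : affine_group B) : Prop :=
  forall (K : closedFieldType) (iota : {rmorphism B -> K})
    (N : geom_points G iota -> Prop),
    is_subgroup N -> is_normal N -> zariski_closed N -> zariski_connected N ->
    is_solvable N -> forall x, N x -> x = 1%g.

(* The tori in G over an algebraically closed field are the images of morphisms
   of algebraic groups from split tori. *)
Definition maximal_torus (B : comPzRingType) (G : affine_group B) (n : nat)
  (tau : gf_hom (torus n B) G) : Prop :=
  forall (K : closedFieldType) (iota : {rmorphism B -> K}) (m : nat)
    (sigma : gf_hom (torus m K) (base_change iota G)),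
    let image_tau (x : geom_points G iota) :=
      exists t, x = tau (restrict iota (base_alg K)) t in
    let image_sigma (x : geom_points G iota) :=
      exists t, x = sigma (base_alg K) t in
    (forall x, image_tau x -> image_sigma x) ->
    forall x, image_sigma x -> image_tau x.

Inductive chevalley_type := B2 | G2 | F4.

Definition chev_char (t : chevalley_type) : nat :=
  match t with B2 => 2%N | G2 => 3%N | F4 => 2%N end.

Lemma chev_char_prime t : prime (chev_char t).
Proof. by case: t. Qed.

Definition chev_rank (t : chevalley_type) : nat :=
  match t with B2 => 2%N | G2 => 2%N | F4 => 4%N end.

(* Cartan matrices, Bourbaki's numbering: the entry (i, j) is the value of the
   coroot of the j-th fundamental root at the i-th one. *)
Definition cartan_rows (t : chevalley_type) : seq (seq int) :=
  match t with
  | B2 => [:: [:: 2; -2]; [:: -1; 2]]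
  | G2 => [:: [:: 2; -1]; [:: -3; 2]]
  | F4 => [:: [:: 2; -1; 0; 0]; [:: -1; 2; -2; 0];
              [:: 0; -1; 2; -1]; [:: 0; 0; -1; 2]]
  end.

Definition cartan (t : chevalley_type) (i j : 'I_(chev_rank t)) : int :=
  nth 0 (nth [::] (cartan_rows t) i) j.

Definition is_long (t : chevalley_type) (i : 'I_(chev_rank t)) : bool :=
  match t with
  | B2 => (i == 0 :> nat)%N
  | G2 => (i == 1 :> nat)%N
  | F4 => (i < 2)%N
  end.

(* The length-interchanging symmetry of the Dynkin diagram. *)
Definition bar (t : chevalley_type) (i : 'I_(chev_rank t)) : 'I_(chev_rank t) :=
  rev_ord i.

Definition pairing (n : nat) (r c : 'rV[int]_n) : int := \sum_i r 0 i * c 0 i.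

(* [Delta] is a system of fundamental roots, with Cartan matrix of type [t], of
   the root system [Phi]; coroots are determined by their reflections. *)
Definition fundamental_system (t : chevalley_type)
  (Phi : 'rV[int]_(chev_rank t) -> Prop)
  (Delta : 'I_(chev_rank t) -> 'rV[int]_(chev_rank t)) : Prop :=
  [/\ forall i, Phi (Delta i),
      \det (\matrix_i Delta i) != 0,
      forall r, Phi r -> exists c : 'I_(chev_rank t) -> nat,
        r = \sum_i Delta i *+ c i \/ r = - \sum_i Delta i *+ c i &
      exists coroot : 'I_(chev_rank t) -> 'rV[int]_(chev_rank t),
        (forall i r, Phi r -> Phi (r - pairing r (coroot i) *: Delta i)) /\
        (forall i j, pairing (Delta i) (coroot j) = cartan i j)].

(* In type B2 both isogeny types, Sp4 and SO5, are covered. [pg_x r] matters only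
   for roots [r]. *)
Record pinned_group (t : chevalley_type) := PinnedGroup {
  pg_group :> affine_group 'F_(chev_char t);
  pg_finite_type : of_finite_type pg_group;
  pg_smooth : formally_smooth pg_group;
  pg_connected : connected_group pg_group;
  pg_semisimple : semisimple pg_group;
  pg_torus : gf_hom (torus (chev_rank t) 'F_(chev_char t)) pg_group;
  pg_torus_closed : closed_immersion pg_torus;
  pg_torus_max : maximal_torus pg_torus;
  pg_Delta : 'I_(chev_rank t) -> 'rV[int]_(chev_rank t);
  pg_DeltaP : fundamental_system (is_root pg_torus) pg_Delta;
  pg_x : 'rV[int]_(chev_rank t) -> gf_hom (Ga 'F_(chev_char t)) pg_group;
  pg_x_closed : forall r, is_root pg_torus r -> closed_immersion (pg_x r);
  pg_x_torus : forall r, is_root pg_torus r ->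
    forall (R : alg 'F_(chev_char t)) (s : torus _ _ R) (a : R),
      (pg_torus R s * pg_x r R a * (pg_torus R s)^-1)%g
      = pg_x r R (character r s * a) }.

Section PrimeField.
Variables (p : nat) (pp : prime p).

Lemma Fp_alg_char (R : alg 'F_p) : p%:R = 0 :> R.
Proof. by rewrite -(rmorph_nat (alg_str R)) (pchar_Fp_0 pp) rmorph0. Qed.

Lemma Fp_exp (b : 'F_p) : b ^+ p = b.
Proof.
have h : p%:R = 0 :> 'F_p := pchar_Fp_0 pp.
by rewrite -[b in RHS]natr_Zp -(rmorph_nat (frob pp h)) /frob natr_Zp.
Qed.

Program Definition ah_frob (R : alg 'F_p) : alg_hom R R :=
  @AlgHom _ R R (frob pp (Fp_alg_char R)) _.
Next Obligation. by move=> R b; rewrite /= /frob -rmorphXn Fp_exp. Qed.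

(* On coordinate rings, the Frobenius endomorphism is a |-> a ^ p. *)
Program Definition frobenius_endo (G : affine_group 'F_p) : gf_hom G G :=
  @GfHom _ G G (fun R x => gmap (ah_frob R) x) _ _.
Next Obligation. by move=> G R x y; apply: gmapM. Qed.
Next Obligation.
move=> G R S h x; apply: alg_hom_ext => a /=.
by rewrite /frob rmorphXn.
Qed.

Variables (k : fieldType) (hk : p \in [pchar k]).

Definition Fp_str (x : 'F_p) : k := (x : nat)%:R.

Lemma Fp_str_nat n : Fp_str n%:R = n%:R.
Proof. by rewrite /Fp_str val_Fp_nat // (GRing.natr_mod_pchar hk). Qed.

Lemma Fp_str_nmod : nmod_morphism Fp_str.
Proof.
split=> [|x y]; first exact: (Fp_str_nat 0).
by rewrite -[x]natr_Zp -[y]natr_Zp -natrD !Fp_str_nat natrD.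
Qed.
Lemma Fp_str_monoid : monoid_morphism Fp_str.
Proof.
split=> [|x y]; first exact: (Fp_str_nat 1).
by rewrite -[x]natr_Zp -[y]natr_Zp -natrM !Fp_str_nat natrM.
Qed.
HB.instance Definition _ := GRing.isNmodMorphism.Build 'F_p k Fp_str Fp_str_nmod.
HB.instance Definition _ :=
  GRing.isMonoidMorphism.Build 'F_p k Fp_str Fp_str_monoid.

(* A field of characteristic [p] as an algebra over the prime field. *)
Definition field_alg : alg 'F_p := Alg (Fp_str : {rmorphism 'F_p -> k}).

Program Definition field_endo (theta : {rmorphism k -> k}) :
  alg_hom field_alg field_alg := @AlgHom _ field_alg field_alg theta _.
Next Obligation. by move=> theta b; apply: rmorph_nat. Qed.

End PrimeField.

(* The exceptional graph endomorphism: [e] is the sign of the root. *)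
Record graph_endo (t : chevalley_type) (X : pinned_group t) := GraphEndo {
  ge_hom :> gf_hom X X;
  ge_square : forall (R : alg 'F_(chev_char t)) (x : X R),
    ge_hom R (ge_hom R x) = frobenius_endo (chev_char_prime t) X R x;
  ge_root : forall (i : 'I_(chev_rank t)) (e : bool)
    (R : alg 'F_(chev_char t)) (a : R),
    ge_hom R (pg_x X ((-1) ^+ e *: pg_Delta X i) R a) =
    pg_x X ((-1) ^+ e *: pg_Delta X (bar i)) R
      (if is_long i then a else a ^+ chev_char t) }.

Section TwistedChevalley.
Variables (t : chevalley_type) (X : pinned_group t) (g : graph_endo X).
Variables (k : fieldType) (hk : chev_char t \in [pchar k]).
Variable theta : {rmorphism k -> k}.

Definition gtheta (x : X (field_alg (chev_char_prime t) hk)) :=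
  g _ (gmap (field_endo _ hk theta) x).

Record twisted_chevalley := TwistedChevalley {
  tc_val : X (field_alg (chev_char_prime t) hk);
  tc_fix : `[< gtheta tc_val = tc_val >] }.

HB.instance Definition _ := [isSub for tc_val].
HB.instance Definition _ := [Choice of twisted_chevalley by <:].

Lemma tc_closed :
  group_closed [pred x : X (field_alg (chev_char_prime t) hk) | `[< gtheta x = x >]].
Proof.
have gtM x y : gtheta (x * y)%g = (gtheta x * gtheta y)%g.
  by rewrite /gtheta gmapM ghM.
have gt1 : gtheta 1%g = 1%g.
  by apply: (mulgI (gtheta 1%g)); rewrite -gtM !mulg1.
have gtV x : gtheta x^-1%g = ((gtheta x)^-1)%g.
  by apply: (mulgI (gtheta x)); rewrite -gtM !mulgV.
split; first exact/asboolP.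
by move=> x y /asboolP ex /asboolP ey; apply/asboolP; rewrite gtM gtV ex ey.
Qed.

HB.instance Definition _ := SubChoice_isSubGroup.Build _ _ twisted_chevalley tc_closed.

End TwistedChevalley.

(* Main.v *)
From HB Require Import structures.
From mathcomp Require Import all_boot all_order all_algebra.
From mathcomp Require Import all_classical topology.
From mathcomp Require Import ring.
Require Import Defs.

(** By the Yoneda lemma the graph endomorphism [g] of the affine group [X] is
    composition with one endomorphism [gamma] of the coordinate ring [A] of [X],
    and [g \o g = Frobenius] says that [gamma (gamma a) = a ^+ p].  Hence
    (Spec A, Spec gamma) is a twisted scheme.  On the other side
    [fr \o theta ^ 2 = id] says that [psi], the inverse of [theta], is a square
    root of the Frobenius of [k], so that (k, psi) is a blended field.

    For a twisted scheme (T, Phi), morphisms of locally ringed spaces from T to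
    Spec A are the same as ring morphisms from A to Gamma(T), that is, points of
    [X] over the F_p-algebra Gamma(T).  Such a morphism commutes with Phi and
    Spec gamma exactly when its point [x] satisfies [g x = Phi^# x].  As both
    sides are group morphisms in [x], these points form a subgroup of
    X(Gamma(T)), functorially in T, and this makes Spec A a twisted group
    scheme.  For T = Spec (k, psi) one has Gamma(T) = k and Phi^# = psi, and the
    condition becomes [g x = psi x], that is [g (theta x) = x]: the points are
    the elements of the twisted Chevalley group.

    Since a twisted group scheme has a group law on its T-points for every
    twisted scheme T, affine or not, the correspondence between morphisms to an
    affine scheme and maps of global sections is needed in full: uniqueness is
    [gmor_inj] and existence is [aff_mor] with [gmor_aff_mor].  The group law is
    built in [twisted_group], and [twisted_pt_const] identifies the points over
    a blended field.  These constructions are made for any affine group over F_p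
    with a square root of its Frobenius endomorphism. *)

Set Implicit Arguments.
Unset Strict Implicit.
Unset Printing Implicit Defensive.

Import GRing.Theory.
Local Open Scope classical_set_scope.
Local Open Scope ring_scope.

(** * Global sections and sheaves *)

Section GlobalSections.
Variable T : ringed_space.

Definition otop : opens T := Opens (@openT T).

Definition gsec : comPzRingType := sect otop.

Lemma sub_otop (W : opens T) : W `<=o` otop.
Proof. by []. Qed.

Definition grestr (W : opens T) : {rmorphism gsec -> sect W} :=
  res (@sub_otop W).

Lemma res_grestr (U W : opens T) (h : W `<=o` U) s :
  res h (grestr U s) = grestr W s.
Proof. exact: res_res. Qed.

Lemma grestr_top s : grestr otop s = s.
Proof. exact: res_id. Qed.

Lemma germ_unit_grestr (x : T) (W : opens T) (s : gsec) :
  W x -> germ_unit x (grestr W s) <-> germ_unit x s.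
Proof. exact: germ_unit_res. Qed.

Lemma germ_unit_gsec (x : T) (s : gsec) :
  germ_unit x s <-> exists W : opens T, W x /\ exists t, grestr W s * t = 1.
Proof.
split=> [[W [h [Wx [t e]]]]|[W [Wx u]]]; last by exists W, (@sub_otop W).
by exists W; split=> //; exists t; rewrite -e; congr (_ * _); apply: res_irr.
Qed.

Lemma sheaf_separated (V : opens T) (s t : sect V) : is_sheaf T ->
  (forall x, V x -> exists (W : opens T) (h : W `<=o` V),
     W x /\ res h s = res h t) -> s = t.
Proof.
move=> shT loc.
pose I := {W : opens T & {h : W `<=o` V | res h s = res h t}}.
have cov x : V x -> exists i : I, projT1 i x.
  by case/loc=> W [h [Wx e]]; exists (existT _ W (exist _ h e)).
have [|r [_ uniq]] := shT I V (fun i => projT1 i)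
  (fun i => proj1_sig (projT2 i)) cov (fun i => res (proj1_sig (projT2 i)) s).
  move=> i j W hi hj.
  have h : W `<=o` V by move=> x /hi; apply: (proj1_sig (projT2 i)).
  by rewrite !(res_res _ _ h).
rewrite -(uniq s) // -(uniq t) // => -[W [h e]] /=; exact/esym.
Qed.

(** Gluing for sections that are specified by a property [R] rather than given
    as a family: since the index set is made of all pairs (open set, section
    with [R]), a statement that such pairs exist near every point is enough to
    start from. *)
Lemma sheaf_glue (V : opens T) (R : forall W : opens T, sect W -> Prop) :
  is_sheaf T ->
  (forall x, V x -> exists (W : opens T) (t : sect W),
     [/\ W x, W `<=o` V & R W t]) ->
  (forall (W W' N : opens T) (h : N `<=o` W) (h' : N `<=o` W') t t',
     R W t -> R W' t' -> res h t = res h' t') ->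
  exists t : sect V, forall (W : opens T) (h : W `<=o` V) t', R W t' ->
    res h t = t'.
Proof.
move=> shT loc glue.
pose I := {W : opens T & {t : sect W | W `<=o` V /\ R W t}}.
have cov x : V x -> exists i : I, projT1 i x.
  by case/loc=> W [t [Wx WV Rt]]; exists (existT _ W (exist _ t (conj WV Rt))).
have [|r [rP _]] := shT I V (fun i => projT1 i)
  (fun i => (proj2_sig (projT2 i)).1) cov (fun i => proj1_sig (projT2 i)).
  by move=> [W [t [WV Rt]]] [W' [t' [WV' Rt']]] N hi hj; apply: glue.
exists r => W h t' Rt'.
have /= <- := rP (existT _ W (exist _ t' (conj h Rt'))); exact: res_irr.
Qed.

End GlobalSections.

Arguments otop T : clear implicits.
Arguments gsec T : clear implicits.

Lemma comap_germ_unit (T Y : ringed_space) (f : lrs_mor T Y) (x : T)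
  (V : opens Y) (s : sect V) : V (f x) ->
  germ_unit x (comap f V s) <-> germ_unit (f x) s.
Proof.
move=> Vx; split; first exact: mlocal.
move=> [W [h [Wx [t e]]]].
have h' : opre (mcont f) W `<=o` opre (mcont f) V by move=> y; apply: h.
exists (opre (mcont f) W), h'; split=> //; exists (comap f W t).
by rewrite (comap_res h) -rmorphM e rmorph1.
Qed.

Section Pullback.
Variables (S T : ringed_space) (h : lrs_mor S T).

(** The map [h^#] on global sections.  The preimage of the whole space is not
    syntactically the whole space, whence the restriction. *)
Definition gpull : {rmorphism gsec T -> gsec S} :=
  res (fun x => id : otop S x -> opre (mcont h) (otop T) x) \o comap h (otop T).

Lemma comap_grestr (V : opens T) s :
  comap h V (grestr V s) = grestr (opre (mcont h) V) (gpull s).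
Proof.
have h' : opre (mcont h) V `<=o` opre (mcont h) (otop T) by [].
by rewrite -(comap_res _ h') /gpull /= (res_res _ _ h').
Qed.

End Pullback.

Lemma gpull_comp (S T Y : ringed_space) (f : lrs_mor T Y) (h : lrs_mor S T) s :
  gpull (lrs_comp f h) s = gpull h (gpull f s).
Proof.
rewrite {1}/gpull /= -{1}[s]grestr_top !comap_grestr.
by rewrite !res_grestr grestr_top.
Qed.

Lemma germ_unit1 (T : ringed_space) (x : T) (U : opens T) :
  U x -> germ_unit x (1 : sect U).
Proof.
by exists U, (fun y Uy => Uy); split=> //; exists 1; rewrite rmorph1 mulr1.
Qed.

Lemma germ_unitM (T : ringed_space) (x : T) (U : opens T) (s t : sect U) :
  germ_unit x (s * t) <-> germ_unit x s /\ germ_unit x t.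
Proof.
split=> [[W [h [Wx [r e]]]]|[[W [h [Wx [r e]]]] [W' [h' [Wx' [r' e']]]]]].
  split; exists W, h; split=> //; [exists (res h t * r)|exists (res h s * r)].
    by rewrite mulrA -rmorphM.
  by rewrite mulrCA mulrA -rmorphM.
have k : ocap W W' `<=o` W by move=> y [].
have k' : ocap W W' `<=o` W' by move=> y [].
have hk : ocap W W' `<=o` U by move=> y [/h].
exists (ocap W W'), hk; split=> //; exists (res k r * res k' r').
rewrite rmorphM mulrACA -(res_res h k) -(res_res h' k' hk) -!rmorphM e e'.
by rewrite !rmorph1 mulr1.
Qed.

(** A germ of a unit can be cancelled, at the price of shrinking the open set.
    Together with [sheaf_separated] this replaces all work in the stalks of [T],
    which are never constructed. *)
Lemma germ_cancel (T : ringed_space) (x : T) (U : opens T) (s t u : sect U) :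
  germ_unit x u -> s * u = t * u ->
  exists (W : opens T) (h : W `<=o` U), W x /\ res h s = res h t.
Proof.
move=> [W [h [Wx [v e]]]] /(congr1 (res h)); rewrite !rmorphM => E.
exists W, h; split=> //.
by rewrite -[LHS]mulr1 -e mulrA E -mulrA e mulr1.
Qed.

(** * Constants on a spectrum *)

Section Constants.
Variable A : comPzRingType.

Lemma ss_const_nmod (U : opens (spec A)) : nmod_morphism (ss_const U).
Proof.
split=> [|a b]; apply: spec_sect_ext => //= P UP; rewrite locD.
by apply: Localization.mkE; rewrite !mulr1.
Qed.
Lemma ss_const_monoid (U : opens (spec A)) : monoid_morphism (ss_const U).
Proof.
split=> [|a b]; apply: spec_sect_ext => //= P UP; rewrite locM.
by apply: Localization.mkE; rewrite !mulr1.
Qed.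

HB.instance Definition _ (U : opens (spec A)) := GRing.isNmodMorphism.Build
  A (spec_sect U) (ss_const U) (ss_const_nmod U).
HB.instance Definition _ (U : opens (spec A)) := GRing.isMonoidMorphism.Build
  A (spec_sect U) (ss_const U) (ss_const_monoid U).

Definition const : {rmorphism A -> gsec (spec A)} := ss_const (otop (spec A)).

Lemma grestr_const (U : opens (spec A)) a :
  grestr U (const a) = ss_const U a.
Proof. exact: spec_sect_ext. Qed.

Lemma germ_unit_const (P : spec A) a : germ_unit P (const a) <-> ~ P a.
Proof.
rewrite (spec_germ_unit (const a) (I : otop (spec A) P)) /=; exact: loc_unit.
Qed.

(** A description of a section as a fraction turns into an equation between
    constants, which any morphism to the spectrum transports. *)
Lemma spec_sect_mul_const (U : opens (spec A)) (s : spec_sect U) a d :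
  (forall P (UP : U P), exists Pd : ~ P d, s P UP = Localization.mk a Pd) ->
  s * ss_const U d = ss_const U a.
Proof.
move=> e; apply: spec_sect_ext => P UP /=; have [Pd ->] := e P UP.
by rewrite locM; apply: Localization.mkE; rewrite !mulr1.
Qed.

Lemma spec_sect_fraction (U : opens (spec A)) (s : spec_sect U) P : U P ->
  exists (N : opens (spec A)) (h : N `<=o` U) (a d : A), N P /\
    forall Q (NQ : N Q), exists Qd : ~ Q d, s Q (h Q NQ) = Localization.mk a Qd.
Proof.
move=> UP; have [N [a [d [NP NU e]]]] := spec_valP s UP.
by exists N, NU, a, d; split=> // Q NQ; apply: e.
Qed.

End Constants.

(** * Morphisms to an affine scheme *)

(** The correspondence from Hom(T, Spec A) to Hom(A, Gamma(T)); for T a sheaf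
    of local rings it is bijective, by [gmor_inj] and [gmor_aff_mor]. *)
Definition gmor (A : comPzRingType) (T : ringed_space)
  (f : lrs_mor T (spec A)) : {rmorphism A -> gsec T} := gpull f \o @const A.

Lemma gmor_comp (A : comPzRingType) (S T : ringed_space)
  (f : lrs_mor T (spec A)) (h : lrs_mor S T) a :
  gmor (lrs_comp f h) a = gpull h (gmor f a).
Proof. exact: gpull_comp. Qed.

Lemma comap_const (A : comPzRingType) (T : ringed_space)
  (f : lrs_mor T (spec A)) (V : opens (spec A)) a :
  comap f V (ss_const V a) = grestr (opre (mcont f) V) (gmor f a).
Proof. by rewrite -grestr_const comap_grestr. Qed.

(** The map of sheaves determines the map of points: locality of the morphism
    says that the ideal [f x] consists of the [a] whose image is not a unit at
    [x]. *)
Lemma gmor_germ_unit (A : comPzRingType) (T : ringed_space)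
  (f : lrs_mor T (spec A)) (x : T) a : germ_unit x (gmor f a) <-> ~ f x a.
Proof.
rewrite -(germ_unit_grestr (W := opre (mcont f) (otop _))) //.
by rewrite -comap_const comap_germ_unit // germ_unit_const.
Qed.

(** The maps of points agree by [gmor_germ_unit].  A section over an open set of
    Spec A is locally a fraction a / d, so its image [t] satisfies
    [t * phi d = phi a] where [phi d] is a unit germ: it only depends on [phi],
    the common map on global sections. *)
Lemma gmor_inj (A : comPzRingType) (T : ringed_space)
  (f g : lrs_mor T (spec A)) : is_sheaf T -> gmor f =1 gmor g -> f = g.
Proof.
move=> shT e.
have efg x : f x = g x.
  apply: prime_ideal_ext => a; have := gmor_germ_unit f x a.
  rewrite e gmor_germ_unit => h.
  by split=> fa; apply: contrapT => /h.
apply: lrs_mor_ext => // V s W hf hg.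
apply: sheaf_separated => // x Wx.
have Vfx : V (f x) := hf x Wx.
have [N [NV [a [d [Nfx es]]]]] := spec_sect_fraction s Vfx.
have Nd : ~ f x d by have [] := es _ Nfx.
have h1 : ocap W (ocap (opre (mcont f) N) (opre (mcont g) N)) `<=o` W.
  by move=> y [].
set W' := ocap _ _ in h1.
have kf : W' `<=o` opre (mcont f) N by move=> y [_ []].
have kg : W' `<=o` opre (mcont g) N by move=> y [_ []].
have W'x : W' x by split; [|split; [|rewrite /= -efg]].
have esd : res NV s * ss_const N d = ss_const N a by exact: spec_sect_mul_const.
have loc (m : lrs_mor T (spec A)) (hm : W `<=o` opre (mcont m) V)
    (km : W' `<=o` opre (mcont m) N) :
    res h1 (res hm (comap m V s)) * grestr W' (gmor m d) = grestr W' (gmor m a).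
  have NV' : opre (mcont m) N `<=o` opre (mcont m) V by move=> y /NV.
  rewrite (res_res hm h1 (res_sub km NV')) -(res_res NV' km) (comap_res NV).
  by rewrite -!(res_grestr km) -!comap_const -!rmorphM esd.
have := loc g hg kg; rewrite -!e -(loc f hf kf) => /esym E.
have ud : germ_unit x (grestr W' (gmor f d)).
  by apply/germ_unit_grestr => //; apply/gmor_germ_unit.
have [M [hM [Mx eM]]] := germ_cancel ud E.
exists M, (res_sub hM h1); split=> //.
by rewrite -!(res_res h1 hM).
Qed.

(** The morphism to Spec A with a given map [phi] on global sections: [x] goes
    to the ideal of all [a] such that [phi a] is not a unit at [x], and a
    section that is locally a / d goes to the section that is locally
    [phi a / phi d]. *)
Section MorphismOfGlobalSections.
Variables (A : comPzRingType) (T : ringed_space).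
Hypotheses (shT : is_sheaf T) (locT : local_stalks T).
Variable phi : {rmorphism A -> gsec T}.

Program Definition aff_pt (x : T) : prime_ideal A :=
  @PrimeIdeal A (fun a => ~ germ_unit x (phi a)) _ _ _ _ _.
Next Obligation.
by move=> x /=; rewrite rmorph0; have [] := @locT x (otop T) I.
Qed.
Next Obligation.
move=> x a b na nb /=; rewrite rmorphD => u.
by have [_ /(_ _ _ u) []] := @locT x (otop T) I.
Qed.
Next Obligation. by move=> x a b nb /=; rewrite rmorphM => /germ_unitM[]. Qed.
Next Obligation. by move=> x /=; apply; rewrite rmorph1; apply: germ_unit1. Qed.
Next Obligation.
move=> x a b /= nab; apply/not_andP => -[ua ub]; apply: nab.
by rewrite rmorphM; apply/germ_unitM.
Qed.

Lemma aff_ptN x a : ~ aff_pt x a <-> germ_unit x (phi a).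
Proof. by split=> [/contrapT|u /(_ u)]. Qed.

Lemma aff_pt_cont : continuous (aff_pt : T -> spec A).
Proof.
apply/continuousP => _ [S ->].
rewrite (_ : _ @^-1` _ =
  \bigcup_(W in [set W : opens T | exists a, S a /\
      exists t, grestr W (phi a) * t = 1]) (W : set T)).
  by apply: bigcup_open => W _; apply: oset_open.
apply/seteqP; split=> x /=.
  by case=> a Sa /contrapT/germ_unit_gsec[W [Wx u]]; exists W => //; exists a.
case=> W [a [Sa [t e]]] Wx; exists a => //; apply/aff_ptN.
by apply/germ_unit_gsec; exists W; split=> //; exists t.
Qed.

(** This makes [phi a / phi d] independent of the fraction: an equality of
    fractions at [aff_pt x] holds after multiplication by some [u] outside this
    ideal, and [phi u] is then a unit near [x]. *)
Lemma aff_frac_eq (W : opens T) a d a' d' :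
  (forall x, W x -> exists (nd : ~ aff_pt x d) (nd' : ~ aff_pt x d'),
     Localization.mk a nd = Localization.mk a' nd') ->
  grestr W (phi a) * grestr W (phi d') = grestr W (phi a') * grestr W (phi d).
Proof.
move=> e; apply: sheaf_separated => // x Wx.
have [nd [nd' /Localization.mk_eq[u nu E]]] := e x Wx.
apply: (@germ_cancel _ _ _ _ _ (grestr W (phi u))).
  by apply/germ_unit_grestr => //; apply/aff_ptN.
by rewrite -!rmorphM mulrC E mulrC.
Qed.

Section Sections.
Variable V : opens (spec A).

Definition aff_frac_on (s : spec_sect V) (W : opens T)
  (h : W `<=o` opre aff_pt_cont V) (a d : A) : Prop :=
  forall x (Wx : W x), exists nd : ~ aff_pt x d,
    s (aff_pt x) (h x Wx) = Localization.mk a nd.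

Lemma aff_frac_res s (W W' : opens T) (h : W `<=o` opre aff_pt_cont V)
    (h' : W' `<=o` opre aff_pt_cont V) a d :
  W' `<=o` W -> aff_frac_on s h a d -> aff_frac_on s h' a d.
Proof.
move=> k e x W'x; have [nd E] := e x (k x W'x); exists nd; rewrite -E.
by congr (spec_val s _); apply: Prop_irrelevance.
Qed.

Lemma aff_frac_on_eq s (W : opens T) (h : W `<=o` opre aff_pt_cont V)
    a d a' d' :
  aff_frac_on s h a d -> aff_frac_on s h a' d' ->
  grestr W (phi a) * grestr W (phi d') = grestr W (phi a') * grestr W (phi d).
Proof.
move=> e e'; apply: aff_frac_eq => x Wx.
have [nd Ed] := e x Wx; have [nd' Ed'] := e' x Wx.
by exists nd, nd'; rewrite -Ed.
Qed.

Lemma aff_frac_unit s (W : opens T) (h : W `<=o` opre aff_pt_cont V) a d x :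
  aff_frac_on s h a d -> W x -> germ_unit x (grestr W (phi d)).
Proof.
move=> e Wx; have [nd _] := e x Wx.
by apply/germ_unit_grestr => //; apply/aff_ptN.
Qed.

(** A section [t] is the image of [s] if it is locally the quotient of [phi a]
    by [phi d] when [s] is a / d.  One such local presentation near each point
    is enough to determine [t] ([aff_comap_uniq]), so every identity about
    [aff_comap] below is proved by exhibiting local fractions. *)
Definition aff_comap_spec (s : spec_sect V) (t : sect (opre aff_pt_cont V)) :=
  forall x, V (aff_pt x) ->
  exists (W : opens T) (h : W `<=o` opre aff_pt_cont V) (a d : A),
  [/\ W x, aff_frac_on s h a d &
      res h t * grestr W (phi d) = grestr W (phi a)].

Lemma aff_comap_uniq s t t' :
  aff_comap_spec s t -> aff_comap_spec s t' -> t = t'.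
Proof.
move=> st st'; apply: sheaf_separated => // x Vx.
have [W [h [a [d [Wx e E]]]]] := st x Vx.
have [W' [h' [a' [d' [Wx' e' E']]]]] := st' x Vx.
have k : ocap W W' `<=o` W by move=> y [].
have k' : ocap W W' `<=o` W' by move=> y [].
have h0 := res_sub k h.
have e0 := aff_frac_res h0 k e; have e0' := aff_frac_res h0 k' e'.
have Ee : res h0 t * grestr (ocap W W') (phi d) = grestr (ocap W W') (phi a).
  by rewrite -(res_res h k) -!(res_grestr k) -rmorphM E.
have Ee' : res h0 t' * grestr (ocap W W') (phi d') = grestr (ocap W W') (phi a').
  by rewrite -(res_res h' k') -!(res_grestr k') -rmorphM E'.
have u : germ_unit x (grestr (ocap W W') (phi d) * grestr (ocap W W') (phi d')).
  apply/germ_unitM.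
  by split; [apply: aff_frac_unit e0 _|apply: aff_frac_unit e0' _].
have [|M [hM [Mx EM]]] := @germ_cancel _ _ _ (res h0 t) (res h0 t') _ u.
  by rewrite mulrA Ee mulrCA Ee' (aff_frac_on_eq e0 e0') mulrC.
exists M, (res_sub hM h0); split=> //.
by rewrite -!(res_res h0 hM).
Qed.

Lemma aff_comap_exists s : exists t, aff_comap_spec s t.
Proof.
have loc x : V (aff_pt x) -> exists (W : opens T)
    (h : W `<=o` opre aff_pt_cont V) (a d : A) (t : sect W),
    [/\ W x, aff_frac_on s h a d & grestr W (phi d) * t = 1].
  move=> Vx; have [N [NV [a [d [Nx e]]]]] := spec_sect_fraction s Vx.
  have [nd _] := e _ Nx; have /aff_ptN/germ_unit_gsec[W [Wx [t E]]] := nd.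
  have k : ocap (opre aff_pt_cont N) W `<=o` W by move=> y [].
  have h' : ocap (opre aff_pt_cont N) W `<=o` opre aff_pt_cont V.
    by move=> y [/NV].
  exists (ocap (opre aff_pt_cont N) W), h', a, d, (res k t); split=> //.
    move=> y [Ny Wy]; have [ny E'] := e _ Ny; exists ny; rewrite -E'.
    by congr (spec_val s _); apply: Prop_irrelevance.
  by rewrite -(res_grestr k) -rmorphM E rmorph1.
pose R (W : opens T) (r : sect W) :=
  exists (h : W `<=o` opre aff_pt_cont V) (a d : A) (t : sect W),
  [/\ aff_frac_on s h a d, grestr W (phi d) * t = 1 & r = grestr W (phi a) * t].
(* The local quotients are glued; their denominators are invertible on the whole
   of [W], not only as germs. *)
have [||t tP] := @sheaf_glue T (opre aff_pt_cont V) R shT.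
- move=> x /loc[W [h [a [d [t [Wx e E]]]]]].
  by exists W, (grestr W (phi a) * t); split=> //; exists h, a, d, t.
- move=> W W' N k k' _ _ [h [a [d [t [e E ->]]]]] [h' [a' [d' [t' [e' E' ->]]]]].
  have h0 := res_sub k h.
  have := aff_frac_on_eq (aff_frac_res h0 k e) (aff_frac_res h0 k' e').
  rewrite !rmorphM !res_grestr => C.
  have {}E : grestr N (phi d) * res k t = 1.
    by rewrite -(res_grestr k) -rmorphM E rmorph1.
  have {}E' : grestr N (phi d') * res k' t' = 1.
    by rewrite -(res_grestr k') -rmorphM E' rmorph1.
  by rewrite -[LHS]mulr1 -E' mulrACA C [res k t * _]mulrC mulrACA E mulr1.
- exists t => x /loc[W [h [a [d [r [Wx e E]]]]]]; exists W, h, a, d; split=> //.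
  rewrite (tP W h (grestr W (phi a) * r)); last by exists h, a, d, r.
  by rewrite -mulrA [r * _]mulrC E mulr1.
Qed.

Definition aff_comap (s : spec_sect V) : sect (opre aff_pt_cont V) :=
  projT1 (cid (aff_comap_exists s)).

Lemma aff_comapP s : aff_comap_spec s (aff_comap s).
Proof. exact: projT2 (cid _). Qed.

Lemma aff_comapE s t : aff_comap_spec s t -> aff_comap s = t.
Proof. exact/aff_comap_uniq/aff_comapP. Qed.

Lemma aff_comap_const a : aff_comap (ss_const V a) = grestr _ (phi a).
Proof.
apply: aff_comapE => x Vx.
have h : opre aff_pt_cont V `<=o` opre aff_pt_cont V by [].
exists (opre aff_pt_cont V), h, a, 1; split=> //.
  by move=> y Vy; exists (@pset1 A (aff_pt y)).
by rewrite res_id !rmorph1 mulr1.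
Qed.

Lemma aff_comap2 s s' x : V (aff_pt x) ->
  exists (W : opens T) (h : W `<=o` opre aff_pt_cont V) (a d a' d' : A),
  [/\ W x, aff_frac_on s h a d, aff_frac_on s' h a' d',
      res h (aff_comap s) * grestr W (phi d) = grestr W (phi a) &
      res h (aff_comap s') * grestr W (phi d') = grestr W (phi a')].
Proof.
move=> Vx; have [W [h [a [d [Wx e E]]]]] := aff_comapP s Vx.
have [W' [h' [a' [d' [Wx' e' E']]]]] := aff_comapP s' Vx.
have k : ocap W W' `<=o` W by move=> y [].
have k' : ocap W W' `<=o` W' by move=> y [].
have h0 := res_sub k h.
exists (ocap W W'), h0, a, d, a', d'; split=> //.
- exact: aff_frac_res e.
- exact: aff_frac_res e'.
- by rewrite -(res_res h k) -!(res_grestr k) -rmorphM E.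
- by rewrite -(res_res h' k') -!(res_grestr k') -rmorphM E'.
Qed.

Lemma aff_comap_nmod : nmod_morphism aff_comap.
Proof.
split=> [|s s'].
  by rewrite -[0]/(ss_const V 0) aff_comap_const !rmorph0.
apply: aff_comapE => x Vx.
have [W [h [a [d [a' [d' [Wx e e' E E']]]]]]] := aff_comap2 s s' Vx.
exists W, h, (a * d' + a' * d), (d * d'); split=> //.
  move=> y Wy /=; have [nd ->] := e y Wy; have [nd' ->] := e' y Wy.
  by exists (Localization.mulP nd nd'); rewrite locD.
by rewrite !rmorphD !rmorphM -E -E' /=; ring.
Qed.

Lemma aff_comap_monoid : monoid_morphism aff_comap.
Proof.
split=> [|s s'].
  by rewrite -[1]/(ss_const V 1) aff_comap_const !rmorph1.
apply: aff_comapE => x Vx.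
have [W [h [a [d [a' [d' [Wx e e' E E']]]]]]] := aff_comap2 s s' Vx.
exists W, h, (a * a'), (d * d'); split=> //.
  move=> y Wy /=; have [nd ->] := e y Wy; have [nd' ->] := e' y Wy.
  by exists (Localization.mulP nd nd'); rewrite locM.
by rewrite !rmorphM -E -E' /=; ring.
Qed.

HB.instance Definition _ := GRing.isNmodMorphism.Build
  (spec_sect V) (sect (opre aff_pt_cont V)) aff_comap aff_comap_nmod.
HB.instance Definition _ := GRing.isMonoidMorphism.Build
  (spec_sect V) (sect (opre aff_pt_cont V)) aff_comap aff_comap_monoid.

End Sections.

Program Definition aff_mor : lrs_mor T (spec A) :=
  @LrsMor T (spec A) aff_pt aff_pt_cont (fun V => @aff_comap V) _ _.
Next Obligation.
move=> V U h h' s; apply/esym/aff_comapE => x Ux.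
have [W [hW [a [d [Wx e E]]]]] := aff_comapP s (h _ Ux).
have k : ocap W (opre aff_pt_cont U) `<=o` W by move=> y [].
have hU : ocap W (opre aff_pt_cont U) `<=o` opre aff_pt_cont U by move=> y [].
exists (ocap W (opre aff_pt_cont U)), hU, a, d; split=> //.
  move=> y [Wy Uy]; have [nd E'] := e y Wy; exists nd; rewrite -E' /=.
  by congr (spec_val s _); apply: Prop_irrelevance.
by rewrite (res_res _ hU (res_sub k hW)) -(res_res hW k) -!(res_grestr k)
  -rmorphM E.
Qed.
Next Obligation.
move=> x V s Vx u.
have [W [h [a [d [Wx e E]]]]] := aff_comapP s Vx.
have [nd es] := e x Wx.
apply/(spec_germ_unit s Vx).
rewrite (_ : s _ Vx = Localization.mk a nd); last first.
  by rewrite -es; congr (spec_val s _); apply: Prop_irrelevance.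
apply/loc_unit/aff_ptN/(germ_unit_grestr _ Wx); rewrite -E.
apply/germ_unitM; split; first by apply/germ_unit_res.
by apply/(germ_unit_grestr _ Wx)/aff_ptN.
Qed.

Lemma gmor_aff_mor : gmor aff_mor =1 phi.
Proof.
move=> a; rewrite -[LHS]grestr_top /gmor /gpull /=.
rewrite [aff_comap _]aff_comap_const.
by rewrite !res_grestr grestr_top.
Qed.

End MorphismOfGlobalSections.

(** * Prime-field algebras *)

Section PrimeFieldAlgebras.
Variables (p : nat) (pp : prime p).

(** Elements of the prime field are multiples of 1, hence every ring morphism
    between algebras over it is linear. *)
Lemma Fp_linear (R S : alg 'F_p) (h : {rmorphism R -> S}) b :
  h (alg_str R b) = alg_str S b.
Proof. by rewrite -[b]natr_Zp !rmorph_nat. Qed.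

Definition Fp_hom (R S : alg 'F_p) (h : {rmorphism R -> S}) : alg_hom R S :=
  AlgHom (Fp_linear h).

Variable R : comPzRingType.
Hypothesis charR : p%:R = 0 :> R.

(** The proofs among the arguments are what the ring morphism structure of this
    map is attached to.  The ring may be zero, as Gamma of the empty scheme. *)
Definition Fp_map of prime p & p%:R = 0 :> R :=
  fun x : 'F_p => (x : nat)%:R : R.

Lemma Fp_map_nat n : Fp_map pp charR n%:R = n%:R.
Proof.
rewrite /Fp_map val_Fp_nat // [in RHS](divn_eq n p).
by rewrite natrD natrM charR mulr0 add0r.
Qed.

Lemma Fp_map_nmod : nmod_morphism (Fp_map pp charR).
Proof.
split=> [|x y]; first exact: (Fp_map_nat 0).
by rewrite -[x]natr_Zp -[y]natr_Zp -natrD !Fp_map_nat natrD.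
Qed.
Lemma Fp_map_monoid : monoid_morphism (Fp_map pp charR).
Proof.
split=> [|x y]; first exact: (Fp_map_nat 1).
by rewrite -[x]natr_Zp -[y]natr_Zp -natrM !Fp_map_nat natrM.
Qed.
HB.instance Definition _ :=
  GRing.isNmodMorphism.Build 'F_p R (Fp_map pp charR) Fp_map_nmod.
HB.instance Definition _ :=
  GRing.isMonoidMorphism.Build 'F_p R (Fp_map pp charR) Fp_map_monoid.

Definition Fp_alg : alg 'F_p := Alg (Fp_map pp charR : {rmorphism 'F_p -> R}).

End PrimeFieldAlgebras.

Section GroupMorphisms.
Variables (G H : groupType) (f : G -> H).
Hypothesis fM : forall x y, f (x * y)%g = (f x * f y)%g.

Lemma grp_morph1 : f 1%g = 1%g.
Proof. by apply: (mulgI (f 1%g)); rewrite -fM !mulg1. Qed.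

Lemma grp_morphV x : f x^-1%g = ((f x)^-1)%g.
Proof. by apply: (mulgI (f x)); rewrite -fM !mulgV grp_morph1. Qed.

End GroupMorphisms.

(** * Frobenius and spectra *)

Lemma gmor_spec_map (A B : comPzRingType) (h : {rmorphism A -> B}) a :
  gmor (spec_map h) a = const B (h a).
Proof.
apply: spec_sect_ext => Q UQ /=; rewrite loc_mapE.
  by rewrite rmorph1; exact: pset1.
by move=> Q1; apply: Localization.mkE; rewrite rmorph1.
Qed.

Lemma gpull_frobenius (p : nat) (pp : prime p) (X : scheme p) s :
  gpull (frobenius pp X) s = s ^+ p.
Proof.
rewrite /gpull /= /frob (res_res _ _ (fun x Ux => Ux)).
exact: res_id.
Qed.

(** A field has a single prime ideal, so a section over its spectrum is one
    fraction, which already lies in the field. *)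
Section SpecField.
Variable k : fieldType.

Program Definition zero_ideal : prime_ideal k :=
  @PrimeIdeal k (fun a => a = 0) _ _ _ _ _.
Next Obligation. by []. Qed.
Next Obligation. by move=> a b -> ->; rewrite addr0. Qed.
Next Obligation. by move=> a b ->; rewrite mulr0. Qed.
Next Obligation. by apply/eqP; rewrite oner_eq0. Qed.
Next Obligation.
by move=> a b /= /eqP; rewrite mulf_eq0 => /orP[]/eqP; [left|right].
Qed.

Lemma prime_ideal_field (P : prime_ideal k) : P = zero_ideal.
Proof.
apply: prime_ideal_ext => a; split=> [Pa|->]; last exact: pset0.
apply/eqP/negP => /negP a0; apply: (@pset1 _ P).
by rewrite -(mulVf a0); apply: psetM.
Qed.

Lemma const_field_inj : injective (const k).
Proof.
move=> a b /(congr1 (fun s => spec_val s (I : otop (spec k) zero_ideal))) /=.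
by case/Localization.mk_eq => u /eqP u0; rewrite !mulr1 => /(mulfI u0).
Qed.

Lemma const_field_surj s : exists a, const k a = s.
Proof.
have [a [d [nd e]]] :=
  Localization.mk_surj (spec_val s (I : otop (spec k) zero_ideal)).
exists (a / d); apply: spec_sect_ext => P UP.
move: (UP); rewrite (prime_ideal_field P) => UZ.
rewrite (_ : UZ = I) ?e; last exact: Prop_irrelevance.
by apply: Localization.mkE; rewrite mulr1 mulfVK //; apply/eqP.
Qed.

End SpecField.

(** * Square roots of Frobenius and twisted group schemes *)

Section TwistedAffineGroup.
Variables (p : nat) (pp : prime p) (G : affine_group 'F_p) (g : gf_hom G G).
Hypothesis g2 : forall (R : alg 'F_p) (x : G R),
  g R (g R x) = frobenius_endo pp G R x.

Let A : alg 'F_p := coord G.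

(** The endomorphism of the coordinate ring that represents [g], obtained by
    evaluating [g] at the universal point. *)
Definition gamma : alg_hom A A := g A (ah_id A).

Lemma gf_endoE (R : alg 'F_p) (x : G R) : g R x = ah_comp x gamma.
Proof.
have {1}-> : x = gmap (x : alg_hom A R) (ah_id A : G A) by apply: alg_hom_ext.
by rewrite gh_nat.
Qed.

Lemma gamma2 a : gamma (gamma a) = a ^+ p.
Proof.
have := g2 (ah_id A : G A); rewrite gf_endoE.
by move=> /(congr1 (fun x : alg_hom A A => x a)).
Qed.

Lemma spec_Fp_char (U : opens (spec A)) : p%:R = 0 :> spec_sect U.
Proof. by rewrite -(rmorph_nat (ss_const U)) (Fp_alg_char pp) rmorph0. Qed.

Definition spec_Fp : scheme p := Scheme (spec_scheme A) spec_Fp_char.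

(** Both sides are morphisms to an affine scheme, so it suffices to compare them
    on global sections, where they are [gamma \o gamma] and the p-th power. *)
Lemma spec_gamma2 :
  @lrs_comp spec_Fp spec_Fp spec_Fp (spec_map gamma) (spec_map gamma)
  = frobenius pp spec_Fp.
Proof.
apply: (gmor_inj (@spec_sheaf A)) => a.
rewrite gmor_comp gmor_spec_map -/(gmor _ _).
rewrite [RHS](@gpull_frobenius p pp spec_Fp).
by rewrite [LHS](gmor_spec_map gamma) gamma2 rmorphXn.
Qed.

Definition twisted_spec : twisted_scheme pp :=
  @TwistedScheme p pp spec_Fp (spec_map gamma) spec_gamma2.

Definition galg (T : scheme p) : alg 'F_p := Fp_alg pp (sch_char (otop T)).

Definition gpull_hom (S T : scheme p) (h : lrs_mor S T) :
  alg_hom (galg T) (galg S) := Fp_hom (R := galg T) (S := galg S) (gpull h).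

Section Points.
Variable T : twisted_scheme pp.

(** Every ring morphism from A to Gamma(T) is linear over F_p, so [gmor f] is a
    point of G over Gamma(T). *)
Definition pt_of (f : lrs_mor T (spec A)) : G (galg T) :=
  Fp_hom (S := galg T) (gmor f).

Lemma pt_of_inj f f' : pt_of f = pt_of f' -> f = f'.
Proof.
have [shT _ _] := schP T.
move=> e; apply: (gmor_inj shT) => a.
by move/(congr1 (fun x : alg_hom A _ => x a)): e.
Qed.

(** Compatibility with the twists, read on points; see [twisted_pt_of]. *)
Definition twisted_pt (x : G (galg T)) : Prop :=
  g _ x = gmap (gpull_hom (ts_phi T)) x.

Lemma twisted_pt_of (f : lrs_mor T (spec A)) :
  twisted_pt (pt_of f) <->
  lrs_comp (ts_phi twisted_spec) f = lrs_comp f (ts_phi T).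
Proof.
have [shT _ _] := schP T.
have L a : gmor (@lrs_comp T (spec A) (spec A) (spec_map gamma) f) a =
    gmor f (gamma a).
  by rewrite gmor_comp gmor_spec_map.
rewrite /twisted_pt gf_endoE; split=> [e|e].
  apply: (gmor_inj shT) => a; rewrite L gmor_comp.
  by move/(congr1 (fun x : alg_hom A _ => x a)): e.
apply: alg_hom_ext => a; apply: etrans (esym (L a)) _.
apply: etrans (gmor_comp f (ts_phi T) a).
exact: (congr1 (fun m : lrs_mor T (spec A) => gmor m a) e).
Qed.

Lemma pt_of_surj (x : G (galg T)) : exists f, pt_of f = x.
Proof.
have [shT locT _] := schP T.
exists (aff_mor shT locT (x : alg_hom A (galg T))).
by apply: alg_hom_ext => a; apply: gmor_aff_mor.
Qed.

Lemma twisted_mor_of_pt (x : G (galg T)) : twisted_pt x ->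
  {f : twisted_mor T twisted_spec | pt_of f = x}.
Proof.
move=> tx; have [f fx] := cid (pt_of_surj x).
by move: tx; rewrite -fx => /twisted_pt_of e; exists (TwistedMor e).
Qed.

Definition mor_of (x : G (galg T)) (tx : twisted_pt x) :=
  sval (twisted_mor_of_pt tx).

Lemma mor_ofK x (tx : twisted_pt x) : pt_of (mor_of tx) = x.
Proof. exact: svalP (twisted_mor_of_pt tx). Qed.

Lemma twisted_pt_mor (f : twisted_mor T twisted_spec) : twisted_pt (pt_of f).
Proof. exact/twisted_pt_of/tm_comm. Qed.

Lemma twisted_mor_inj (f f' : twisted_mor T twisted_spec) :
  pt_of f = pt_of f' -> f = f'.
Proof.
move=> /pt_of_inj; case: f f' => f c [f' c'] /= e; subst f'.
by congr TwistedMor; apply: Prop_irrelevance.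
Qed.

Lemma twisted_pt1 : twisted_pt 1%g.
Proof. by rewrite /twisted_pt !grp_morph1 //; [apply: gmapM|apply: ghM]. Qed.

Lemma twisted_ptM x y : twisted_pt x -> twisted_pt y -> twisted_pt (x * y)%g.
Proof. by rewrite /twisted_pt gmapM ghM => -> ->. Qed.

Lemma twisted_ptV x : twisted_pt x -> twisted_pt (x^-1)%g.
Proof.
rewrite /twisted_pt (grp_morphV (@ghM _ _ _ g _)) => ->.
by rewrite (grp_morphV (@gmapM _ G _ _ _)).
Qed.

(* The group structure is transported from G(Gamma(T)) along [pt_of]. *)
Definition tw_mul f f' :=
  mor_of (twisted_ptM (twisted_pt_mor f) (twisted_pt_mor f')).
Definition tw_one := mor_of twisted_pt1.
Definition tw_inv f := mor_of (twisted_ptV (twisted_pt_mor f)).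

Lemma tw_mulA : associative tw_mul.
Proof. by move=> x y z; apply: twisted_mor_inj; rewrite !mor_ofK mulgA. Qed.
Lemma tw_mul1g : left_id tw_one tw_mul.
Proof. by move=> x; apply: twisted_mor_inj; rewrite !mor_ofK mul1g. Qed.
Lemma tw_mulg1 : right_id tw_one tw_mul.
Proof. by move=> x; apply: twisted_mor_inj; rewrite !mor_ofK mulg1. Qed.
Lemma tw_mulVg : left_inverse tw_one tw_inv tw_mul.
Proof. by move=> x; apply: twisted_mor_inj; rewrite !mor_ofK mulVg. Qed.
Lemma tw_mulgV : right_inverse tw_one tw_inv tw_mul.
Proof. by move=> x; apply: twisted_mor_inj; rewrite !mor_ofK mulgV. Qed.

End Points.

Lemma pt_of_comp (S T : twisted_scheme pp) (h : twisted_mor S T)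
  (f : twisted_mor T twisted_spec) :
  pt_of (tm_comp f h) = gmap (gpull_hom h) (pt_of f).
Proof. by apply: alg_hom_ext => a; apply: gmor_comp. Qed.

Lemma tw_nat (T S : twisted_scheme pp) (h : twisted_mor S T)
  (x y : twisted_mor T twisted_spec) :
  tm_comp (tw_mul x y) h = tw_mul (tm_comp x h) (tm_comp y h).
Proof.
by apply: twisted_mor_inj; rewrite mor_ofK !pt_of_comp mor_ofK gmapM.
Qed.

Definition twisted_group : twisted_group_scheme pp :=
  TwistedGroupScheme tw_mulA tw_mul1g tw_mulg1 tw_mulVg tw_mulgV tw_nat.

End TwistedAffineGroup.

(** * Points over a blended field *)

Section BlendedPoints.
Variables (p : nat) (pp : prime p) (G : affine_group 'F_p) (g : gf_hom G G).
Hypothesis g2 : forall (R : alg 'F_p) (x : G R),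
  g R (g R x) = frobenius_endo pp G R x.
Variable b : blended_field p.

Let S := spec_blended pp b.
Let kb : alg 'F_p := field_alg pp (bf_char b).

Definition const_hom : alg_hom kb (galg pp S) :=
  Fp_hom (R := kb) (S := galg pp S) (const b).

Lemma gmap_const_inj (x y : G kb) :
  gmap const_hom x = gmap const_hom y -> x = y.
Proof.
move=> e; apply: alg_hom_ext => a; apply: const_field_inj.
by move/(congr1 (fun z : alg_hom (coord G) _ => z a)): e.
Qed.

Lemma gmap_const_surj (y : G (galg pp S)) :
  exists x : G kb, gmap const_hom x = y.
Proof.
have [c cK] := boolp.choice (@const_field_surj b).
have Kc : cancel (const b) c by move=> a; apply: const_field_inj.
pose cB := GRing.isNmodMorphism.Build _ _ c (can2_nmod_morphism Kc cK).
pose cM := GRing.isMonoidMorphism.Build _ _ c (can2_monoid_morphism Kc cK).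
pose cR : {rmorphism gsec (spec b) -> b} := HB.pack c cB cM.
exists (gmap (Fp_hom (R := galg pp S) (S := kb) cR) y).
by apply: alg_hom_ext => a; apply: cK.
Qed.

(** The inclusion of constants from k to Gamma(Spec k) carries [psi] to the map
    induced by Spec psi, by [gmor_spec_map]; being injective on points, it
    reflects the twist condition. *)
Lemma twisted_pt_const (x : G kb) :
  twisted_pt g (T := S) (gmap const_hom x) <->
  g kb x = gmap (field_endo pp (bf_char b) (bf_psi b)) x.
Proof.
have E : gmap (gpull_hom pp (ts_phi S)) (gmap const_hom x) =
    gmap const_hom (gmap (field_endo pp (bf_char b) (bf_psi b)) x).
  by apply: alg_hom_ext => a; apply: gmor_spec_map.
rewrite /twisted_pt E gh_nat; split=> [|-> //]; exact: gmap_const_inj.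
Qed.

End BlendedPoints.

Theorem theorem4p4 (t : chevalley_type) (X : pinned_group t)
  (g : graph_endo X) (k : fieldType) (hk : chev_char t \in [pchar k]%R)
  (theta : {rmorphism k -> k}) (theta_aut : bijective theta)
  (theta_sq : forall x : k, (theta (theta x) ^+ chev_char t)%R = x) :
  exists (Y : twisted_group_scheme (chev_char_prime t))
         (b : blended_field (chev_char t))
         (f : {multiplicative twisted_chevalley g hk theta ->
                 tg_points Y (spec_blended (chev_char_prime t) b)}),
    bijective f.
Proof.
have [psi thetaK psiK] := theta_aut.
pose psiB := GRing.isNmodMorphism.Build _ _ psi (can2_nmod_morphism thetaK psiK).
pose psiM :=
  GRing.isMonoidMorphism.Build _ _ psi (can2_monoid_morphism thetaK psiK).
pose psiR : {rmorphism k -> k} := HB.pack psi psiB psiM.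
(* The inverse of [theta] is a square root of the Frobenius. *)
have psi2 x : psiR (psiR x) = (x ^+ chev_char t)%R.
  by rewrite -[x in LHS]theta_sq -!rmorphXn /= !thetaK.
pose b := BlendedField hk psi2.
pose g2 := ge_square g.
have twP (x : twisted_chevalley g hk theta) :
    twisted_pt g (T := spec_blended _ b)
      (gmap (const_hom (chev_char_prime t) b) (tc_val x)).
  apply/twisted_pt_const; case: x => x /= /asboolP; rewrite /gtheta => e.
  by rewrite -[in RHS]e gh_nat; apply: alg_hom_ext => a; rewrite /= thetaK.
(* A fixed point of [g theta] is a point with [g x = psi x], viewed over the
   isomorphic ring Gamma(Spec k). *)
pose f x : tg_points (twisted_group g2) (spec_blended _ b) := mor_of g2 (twP x).
have fE x : pt_of (f x) = gmap (const_hom _ b) (tc_val x) by apply: mor_ofK.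
have fM : {morph f : x y / (x * y)%g}.
  move=> x y; apply: (twisted_mor_inj (g2 := g2)).
  by rewrite [RHS]mor_ofK !fE gmapM.
pose fR : {multiplicative _ -> _} := HB.pack f (isMultiplicative.Build _ _ f fM).
exists (twisted_group g2), b, fR.
have f_inj : injective f.
  move=> x y exy; have := fE x; rewrite exy fE => /gmap_const_inj/esym.
  exact: val_inj.
have f_surj y : exists x, f x = y.
  have [x xy] := gmap_const_surj (pt_of y).
  have tx : gtheta g theta x = x.
    have := twisted_pt_mor (g2 := g2) y; rewrite -xy => /twisted_pt_const e.
    by rewrite /gtheta gh_nat e; apply: alg_hom_ext => a; rewrite /= psiK.
  exists (TwistedChevalley (asboolT tx)); apply: (twisted_mor_inj (g2 := g2)).
  by rewrite fE.
have [h hK] := boolp.choice f_surj.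
by exists h => [x|y]; [apply: f_inj; rewrite hK|apply: hK].
Qed.
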